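(* Let $E=(E^0,E^1,r_E,s_E)$ and $F=(F^0,F^1,r_F,s_F)$ be graphs, let $H$ be a Hilbert space, and let $\tau_1:\mathcal{T}_{X(E)}\to B(H)$ and $\tau_2:\mathcal{T}_{X(F)}\to B(H)$ be two faithful non-degenerate $*$-representations. Suppose that $\{\tau_1(\delta_v):v\in E^0\}'=\{\tau_2(\delta_v):v\in F^0\}'$, call this von Neumann algebra $W$, and suppose that $Ad_{\tau_1}=Ad_{\tau_2}$ on $W$, i.e. $\sum_{e\in E^1}\tau_1(\delta_e)w\tau_1(\delta_e)^*=\sum_{f\in F^1}\tau_2(\delta_f)w\tau_2(\delta_f)^*$ for all $w\in W$. Then there is a coherent unitary equivalence $(U,\alpha)$ between $X(E)$ and $X(F)$ such that $\tau_1=\tau_2\circ\Gamma_{U,\alpha}$.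
   Context: A graph is a tuple $E=(E^0,E^1,r,s)$ with vertex set $E^0$, edge set $E^1$ and range and source maps $r,s:E^1\to E^0$; $E^0$ and $E^1$ are assumed at most countable, and $E^0$ is regarded as a discrete space. A $C^*$-correspondence over a $C^*$-algebra $A$ is a right Hilbert $A$-module $X$ together with a $*$-homomorphism $\phi=\phi_X:A\to L(X)$, where $L(X)$ is the algebra of adjointable $A$-module maps on $X$. The graph correspondence $X(E)$ is the set of functions $x:E^1\to\mathbb{C}$ for which $\hat{x}(v):=\sum_{e\in s^{-1}(v)}|x(e)|^2$ defines a function $\hat{x}\in C_0(E^0)$. It is a $C^*$-correspondence over $C_0(E^0)$ via $(x\cdot a)(e)=x(e)a(s(e))$, $(\phi(a)x)(e)=a(r(e))x(e)$, $\langle x,y\rangle(v)=\sum_{e\in s^{-1}(v)}\overline{x(e)}y(e)$. The functions $\delta_e\in X(E)$ ($e\in E^1$) and $\delta_v\in C_0(E^0)$ ($v\in E^0$) are the point masses. A Toeplitz representation of a $C^*$-correspondence $X$ over $A$ in a $C^*$-algebra $B$ is a pair $(\sigma,\pi)$ of a linear map $\sigma:X\to B$ and a $*$-homomorphism $\pi:A\to B$ with $\sigma(x\cdot a)=\sigma(x)\pi(a)$, $\sigma(\phi(a)x)=\pi(a)\sigma(x)$ and $\pi(\langle x,y\rangle)=\sigma(x)^*\sigma(y)$ for all $x,y\in X$, $a\in A$. The Toeplitz algebra $\mathcal{T}_X$ is the universal $C^*$-algebra carrying a Toeplitz representation $(\sigma_u,\pi_u)$ of $X$: for every Toeplitz representation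 $(\sigma,\pi)$ of $X$ in a $C^*$-algebra $B$ there is a unique $*$-homomorphism $\rho:\mathcal{T}_X\to B$ with $\sigma=\rho\circ\sigma_u$ and $\pi=\rho\circ\pi_u$. Elements of $X(E)$ and $C_0(E^0)$ are identified with their images in $\mathcal{T}_{X(E)}$ under $\sigma_u$ and $\pi_u$. A coherent unitary equivalence between correspondences $X$ over $A$ and $Y$ over $B$ is a pair $(U,\alpha)$ of a bijective linear map $U:X\to Y$ and a $*$-isomorphism $\alpha:A\to B$ such that $U(x\cdot a)=(Ux)\cdot\alpha(a)$, $U(\phi_X(a)x)=\phi_Y(\alpha(a))Ux$ and $\langle Ux,y\rangle_Y=\alpha(\langle x,U^{-1}y\rangle_X)$ for all $x\in X$, $y\in Y$, $a\in A$. For such $(U,\alpha)$ between $X(E)$ and $X(F)$, $\Gamma_{U,\alpha}:\mathcal{T}_{X(E)}\to\mathcal{T}_{X(F)}$ denotes the induced $*$-isomorphism, satisfying $\Gamma_{U,\alpha}(\delta_e)=U\delta_e$ and $\Gamma_{U,\alpha}(\delta_v)=\alpha(\delta_v)$ for all $e\in E^1$, $v\in E^0$. For a $*$-representation $\tau:\mathcal{T}_{X(E)}\to B(H)$, $Ad_\tau$ is the $*$-endomorphism of the von Neumann algebra $\{\tau(\delta_v):v\in E^0\}'$ given by $Ad_\tau(w)=\sum_{e\in E^1}\tau(\delta_e)w\tau(\delta_e)^*$ (sum converging in the strong operator topology). The prime denotes the commutant in $B(H)$. *)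

(* Defs.v *)
From HB Require Import structures.
From mathcomp Require Import all_boot all_order all_algebra.
From mathcomp Require Import finmap.
From mathcomp Require Import complex ring lra.
From mathcomp Require Import all_classical reals ereal topology normedtype esum.

Set Implicit Arguments.
Unset Strict Implicit.
Unset Printing Implicit Defensive.

Import Order.TTheory GRing.Theory Num.Theory.
Import numFieldNormedType.Exports.

Local Open Scope classical_set_scope.
Local Open Scope ring_scope.

(* C*-algebras are not assumed unital, hence a multiplication amul that does
   not come from a MathComp ring structure. *)
HB.mixin Record isStarAlgebra (R : realType) A & GRing.Lmodule R[i] A := {
  amul : A -> A -> A;
  star : A -> A;
  amulA : associative amul;
  amulDl : left_distributive amul +%R;
  amulDr : right_distributive amul +%R;
  amulZl : forall (c : R[i]) (a b : A), amul (c *: a) b = c *: amul a b;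
  amulZr : forall (c : R[i]) (a b : A), amul a (c *: b) = c *: amul a b;
  starK : involutive star;
  starD : {morph star : a b / a + b};
  starZ : forall (c : R[i]) (a : A), star (c *: a) = c^* *: star a;
  starM : forall a b : A, star (amul a b) = amul (star b) (star a)
}.

#[short(type="starAlgType")]
HB.structure Definition StarAlgebra (R : realType) :=
  {A of isStarAlgebra R A & GRing.Lmodule R[i] A}.

HB.mixin Record isCStarAlgebra (R : realType) A
    & StarAlgebra R A & CompleteNormedModule R[i] A := {
  norm_amul : forall a b : A, `|amul a b| <= `|a| * `|b|;
  norm_star_amul : forall a : A, `|amul (star a) a| = `|a| ^+ 2
}.

#[short(type="cstarAlgType")]
HB.structure Definition CStarAlgebra (R : realType) :=
  {A of isCStarAlgebra R A & StarAlgebra R A & CompleteNormedModule R[i] A}.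

(* The inner product is linear in the second variable, as for the
   C_0(E^0)-valued inner product of a graph correspondence. *)
HB.mixin Record isHilbert (R : realType) H & CompleteNormedModule R[i] H := {
  hdot : H -> H -> R[i];
  hdotDr : forall x y z : H, hdot x (y + z) = hdot x y + hdot x z;
  hdotZr : forall (c : R[i]) (x y : H), hdot x (c *: y) = c * hdot x y;
  hdotC : forall x y : H, hdot x y = (hdot y x)^*;
  hdot_norm : forall x : H, hdot x x = `|x| ^+ 2
}.

#[short(type="hilbertType")]
HB.structure Definition Hilbert (R : realType) :=
  {H of isHilbert R H & CompleteNormedModule R[i] H}.

Section UnorderedSum.
Variables (K : numDomainType) (V : normedZmodType K) (I : choiceType).

(* f is summable on D with sum l along the net of finite subsets of D; usum is
   0 when the family is not summable. *)
Definition has_sum (D : set I) (f : I -> V) (l : V) : Prop :=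
  forall eps : K, 0 < eps -> exists2 A, fsets D A &
    forall B, fsets D B -> A `<=` B -> `|\sum_(i \in B) f i - l| < eps.

Definition usum (D : set I) (f : I -> V) : V := xget 0 [set l | has_sum D f l].

End UnorderedSum.

Record graph := Graph {
  vertex : countType;
  edge : countType;
  rng : edge -> vertex;
  src : edge -> vertex
}.

Section C0.
Variables (R : realType) (V : countType).

(* Membership in C_0(V) for the discrete space V, whose compact subsets are the
   finite ones. *)
Definition vanishing (a : V -> R[i]) : Prop :=
  forall eps : R[i], 0 < eps -> finite_set [set v | eps <= `|a v|].

(* R[i]^o is R[i] seen as a module over itself, so that functions into it form
   an lmodType R[i]. *)
Definition vanishing_pred : {pred V -> R[i]^o} := fun a => `[< vanishing a >].

Lemma vanishing_dom (a b : V -> R[i]) (M : R[i]) :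
  vanishing a -> (forall v, `|b v| <= M * `|a v|) -> vanishing b.
Proof.
move=> va le_ba eps eps0.
have M1 : 0 < `|M| + 1 by rewrite ltr_wpDl.
have := va (eps / (`|M| + 1)) (divr_gt0 eps0 M1).
apply: sub_finite_set => v /= le_eps; rewrite ler_pdivrMr//.
apply: (le_trans le_eps); apply: (le_trans (le_ba v)).
have [->|a0] := eqVneq (a v) 0; first by rewrite normr0 !(mulr0, mul0r).
rewrite mulrC ler_pM2l ?normr_gt0//.
have Mr : 0 <= M.
  by have := le_trans (normr_ge0 _) (le_ba v); rewrite pmulr_lge0// normr_gt0.
by rewrite (ger0_norm Mr) lerDl.
Qed.

Lemma vanishing_add (a b c : V -> R[i]) :
  vanishing a -> vanishing b -> (forall v, `|c v| <= `|a v| + `|b v|) ->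
  vanishing c.
Proof.
move=> va vb le_c eps eps0.
have e20 : 0 < eps / 2 by rewrite divr_gt0.
have : finite_set ([set v | eps / 2 <= `|a v|] `|` [set v | eps / 2 <= `|b v|]).
  by rewrite finite_setU; split; [exact: va|exact: vb].
apply: sub_finite_set => v /= le_eps.
have [?|] := boolP (eps / 2 <= `|a v|); first by left.
rewrite -real_ltNge ?normr_real ?gtr0_real// => a_lt.
right; rewrite real_leNgt ?normr_real ?gtr0_real//; apply/negP => b_lt.
have := le_lt_trans (le_trans le_eps (le_c v)) (ltrD a_lt b_lt).
by rewrite -splitr ltxx.
Qed.

Lemma vanishing_submod : submod_closed vanishing_pred.
Proof.
split=> [|c a b /asboolP va /asboolP vb]; apply/asboolP.
  move=> eps eps0; apply: sub_finite_set (finite_set0 V) => v /=.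
  by rewrite normr0 lt_geF.
apply: (@vanishing_add (fun v => c * a v) b) => // [|v]; last first.
  exact: ler_normD.
by apply: (vanishing_dom (M := `|c|) va) => v; rewrite normrM.
Qed.

HB.instance Definition _ := GRing.isSubmodClosed.Build _ _ vanishing_pred
  vanishing_submod.

Record C0 := MkC0 {
  c0_val :> V -> R[i]^o;
  c0_valP : c0_val \in vanishing_pred
}.

HB.instance Definition _ := [isSub for c0_val].
HB.instance Definition _ := [Choice of C0 by <:].
HB.instance Definition _ := [SubChoice_isSubLmodule of C0 by <:].

Lemma c0_vanishing (a : C0) : vanishing a.
Proof. exact/asboolP/c0_valP. Qed.

Lemma c0_ext (a b : C0) : (forall v, a v = b v) -> a = b.
Proof. by move=> ab; apply/val_inj/funext. Qed.

Lemma c0_mul_subproof (a b : C0) :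
  (fun v => a v * b v : R[i]^o) \in vanishing_pred.
Proof.
apply/asboolP.
have fin1 : finite_set ([set v | 1 <= `|b v|]) by apply: c0_vanishing.
move=> eps eps0.
have : finite_set ([set v | 1 <= `|b v|] `|` [set v | eps <= `|a v|]).
  by rewrite finite_setU; split; [|exact: c0_vanishing].
apply: sub_finite_set => v /=; rewrite normrM => le_eps.
have [?|] := boolP (1 <= `|b v|); first by left.
rewrite -real_ltNge ?normr_real// => b_lt; right.
by rewrite (le_trans le_eps)// ler_piMr// ltW.
Qed.
Definition c0_mul (a b : C0) : C0 := MkC0 (c0_mul_subproof a b).

Lemma c0_star_subproof (a : C0) : (fun v => (a v : R[i])^* : R[i]^o) \in vanishing_pred.
Proof.
apply/asboolP => eps eps0.
by apply: sub_finite_set (c0_vanishing a eps0) => v /=; rewrite norm_conjC.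
Qed.
Definition c0_star (a : C0) : C0 := MkC0 (c0_star_subproof a).

Lemma c0_delta_subproof (v0 : V) :
  (fun v => (v == v0)%:R : R[i]^o) \in vanishing_pred.
Proof.
apply/asboolP => eps eps0; apply: sub_finite_set (finite_set1 v0) => v /=.
by case: eqP => // _; rewrite normr0 lt_geF.
Qed.
Definition c0_delta (v0 : V) : C0 := MkC0 (c0_delta_subproof v0).

Lemma c0_mulA : associative c0_mul.
Proof. by move=> a b c; apply: c0_ext => v; exact: mulrA. Qed.
Lemma c0_mulDl : left_distributive c0_mul +%R.
Proof. by move=> a b c; apply: c0_ext => v; exact: mulrDl. Qed.
Lemma c0_mulDr : right_distributive c0_mul +%R.
Proof. by move=> a b c; apply: c0_ext => v; exact: mulrDr. Qed.
Lemma c0_mulZl (c : R[i]) (a b : C0) : c0_mul (c *: a) b = c *: c0_mul a b.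
Proof. by apply: c0_ext => v; rewrite /= -scalerAl. Qed.
Lemma c0_mulZr (c : R[i]) (a b : C0) : c0_mul a (c *: b) = c *: c0_mul a b.
Proof. by apply: c0_ext => v; rewrite /= -scalerAr. Qed.
Lemma c0_starK : involutive c0_star.
Proof. by move=> a; apply: c0_ext => v; exact: conjCK. Qed.
Lemma c0_starD : {morph c0_star : a b / a + b}.
Proof. by move=> a b; apply: c0_ext => v; exact: rmorphD. Qed.
Lemma c0_starZ (c : R[i]) (a : C0) : c0_star (c *: a) = c^* *: c0_star a.
Proof. by apply: c0_ext => v; exact: rmorphM. Qed.
Lemma c0_starM (a b : C0) : c0_star (c0_mul a b) = c0_mul (c0_star b) (c0_star a).
Proof. by apply: c0_ext => v; rewrite /= rmorphM mulrC. Qed.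

HB.instance Definition _ := isStarAlgebra.Build R C0 c0_mulA c0_mulDl c0_mulDr
  c0_mulZl c0_mulZr c0_starK c0_starD c0_starZ c0_starM.

End C0.

Section GraphCorrespondence.
Variables (R : realType) (E : graph).
Local Notation V := (vertex E).
Local Notation A := (C0 R V).
Local Notation normc := Normc.normc.

Definition fiber (v : V) : set (edge E) := [set e | src e = v].

Definition xhat (x : edge E -> R[i]) (v : V) : \bar R :=
  \esum_(e in fiber v) (normc (x e) ^+ 2)%:E.

Definition is_graph_vector (x : edge E -> R[i]) : Prop :=
  (forall v, (xhat x v < +oo)%E) /\
  vanishing (fun v => (fine (xhat x v))%:C%C).

Definition graph_vector_pred : {pred edge E -> R[i]^o} :=
  fun x => `[< is_graph_vector x >].

Lemma normr_normc (z : R[i]) : `|z| = (normc z)%:C%C.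
Proof. by []. Qed.

Lemma normc_ge0 (z : R[i]) : 0 <= normc z.
Proof. by case: z => a b; exact: sqrtr_ge0. Qed.

Lemma xhat_ge0 (x : edge E -> R[i]) v : (0 <= xhat x v)%E.
Proof. by apply: esum_ge0 => e _; rewrite lee_fin sqr_ge0. Qed.

Lemma xhat_fine_norm x v :
  `|(fine (xhat x v))%:C%C| = (fine (xhat x v))%:C%C :> R[i].
Proof. by rewrite ger0_norm// ler0c fine_ge0// xhat_ge0. Qed.

Lemma xhat_fin x v : is_graph_vector x -> xhat x v \is a fin_num.
Proof. by move=> [xoo _]; rewrite ge0_fin_numE// xhat_ge0. Qed.

Lemma esum_scale (x : edge E -> R[i]) (M : R) v : 0 <= M ->
  (\esum_(e in fiber v) (M * normc (x e) ^+ 2)%:E <= M%:E * xhat x v)%E.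
Proof.
move=> M0; apply: ge_ereal_sup => _ [B [finB sB] <-].
apply: (@le_trans _ _ (M%:E * \sum_(e \in B) (normc (x e) ^+ 2)%:E)%E).
  rewrite ge0_mule_fsumr//; last by move=> e; rewrite lee_fin sqr_ge0.
by rewrite lee_wpmul2l ?lee_fin//; apply: ereal_sup_ubound; exists B.
Qed.

Lemma xhat_le (x y z : edge E -> R[i]) (M : R) v : 0 <= M ->
  (forall e, src e = v ->
    normc (z e) ^+ 2 <= M * normc (x e) ^+ 2 + M * normc (y e) ^+ 2) ->
  (xhat z v <= M%:E * xhat x v + M%:E * xhat y v)%E.
Proof.
move=> M0 le_z.
apply: (@le_trans _ _ (\esum_(e in fiber v)
    ((M * normc (x e) ^+ 2)%:E + (M * normc (y e) ^+ 2)%:E))%E).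
  by apply: le_esum => e ev; rewrite -EFinD lee_fin le_z.
rewrite esumD; last 2 first.
- by move=> e _; rewrite lee_fin mulr_ge0// sqr_ge0.
- by move=> e _; rewrite lee_fin mulr_ge0// sqr_ge0.
by apply: leeD; exact: esum_scale.
Qed.

Lemma graph_vector_dom (x y z : edge E -> R[i]) (M : R) : 0 <= M ->
  is_graph_vector x -> is_graph_vector y ->
  (forall e,
    normc (z e) ^+ 2 <= M * normc (x e) ^+ 2 + M * normc (y e) ^+ 2) ->
  is_graph_vector z.
Proof.
move=> M0 gx gy le_z.
have le_zv v := xhat_le M0 (fun e (_ : src e = v) => le_z e).
have Mfin (w : edge E -> R[i]) v : is_graph_vector w ->
    (M%:E * xhat w v)%E \is a fin_num.
  by move=> gw; rewrite fin_numM// xhat_fin.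
have zoo v : (xhat z v < +oo)%E.
  by apply: le_lt_trans (le_zv v) _; rewrite ltey_eq fin_numD !Mfin.
split=> //.
have MC : 0 <= M%:C%C :> R[i] by rewrite ler0c.
apply: (@vanishing_add _ _ (fun v => M%:C%C * (fine (xhat x v))%:C%C)
                           (fun v => M%:C%C * (fine (xhat y v))%:C%C)).
- by apply: (vanishing_dom (M := M%:C%C) gx.2) => v; rewrite normrM ger0_norm.
- by apply: (vanishing_dom (M := M%:C%C) gy.2) => v; rewrite normrM ger0_norm.
move=> v; rewrite !normrM (ger0_norm MC) !xhat_fine_norm.
rewrite -!rmorphM -rmorphD lecR -lee_fin EFinD !EFinM.
have zf : xhat z v \is a fin_num by rewrite ge0_fin_numE// xhat_ge0.
by rewrite (fineK zf) (fineK (xhat_fin v gx)) (fineK (xhat_fin v gy)).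
Qed.

Lemma is_graph_vector0 : is_graph_vector (fun=> 0).
Proof.
have x0 v : xhat (fun=> 0) v = 0%E.
  by rewrite /xhat esum1// => e _; rewrite Normc.normc0 expr0n.
split=> [v|]; first by rewrite x0 ltry.
move=> eps eps0; apply: sub_finite_set (finite_set0 V) => v /=.
by rewrite x0 normr0 lt_geF.
Qed.

Lemma graph_vector_submod : submod_closed graph_vector_pred.
Proof.
split=> [|c x y /asboolP gx /asboolP gy]; apply/asboolP.
  exact: is_graph_vector0.
pose M := 2 * normc c ^+ 2 + 2.
have M0 : 0 <= M by rewrite addr_ge0// mulr_ge0// sqr_ge0.
apply: (graph_vector_dom M0 gx gy) => e.
have le1 : normc (c * x e + y e) <= normc c * normc (x e) + normc (y e).
  by rewrite -Normc.normcM; exact: le_normcD.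
apply: (@le_trans _ _ ((normc c * normc (x e) + normc (y e)) ^+ 2)).
  by rewrite ler_sqr ?nnegrE ?addr_ge0 ?mulr_ge0 ?normc_ge0.
apply: (@le_trans _ _ (2 * (normc c * normc (x e)) ^+ 2 + 2 * normc (y e) ^+ 2)).
  rewrite -subr_ge0.
  have -> : 2 * (normc c * normc (x e)) ^+ 2 + 2 * normc (y e) ^+ 2 -
     (normc c * normc (x e) + normc (y e)) ^+ 2 =
     (normc c * normc (x e) - normc (y e)) ^+ 2 by ring.
  exact: sqr_ge0.
apply: lerD; first rewrite exprMn mulrA.
  by apply: ler_wpM2r; [exact: sqr_ge0|rewrite lerDl].
apply: ler_wpM2r; first exact: sqr_ge0.
by rewrite lerDr mulr_ge0// sqr_ge0.
Qed.

HB.instance Definition _ := GRing.isSubmodClosed.Build _ _ graph_vector_pred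
  graph_vector_submod.

Record graph_corr := MkGraphCorr {
  gc_val :> edge E -> R[i]^o;
  gc_valP : gc_val \in graph_vector_pred
}.

HB.instance Definition _ := [isSub for gc_val].
HB.instance Definition _ := [Choice of graph_corr by <:].
HB.instance Definition _ := [SubChoice_isSubLmodule of graph_corr by <:].

Lemma gc_vectorP (x : graph_corr) : is_graph_vector x.
Proof. exact/asboolP/gc_valP. Qed.

Lemma gc_ext (x y : graph_corr) : (forall e, x e = y e) -> x = y.
Proof. by move=> xy; apply/val_inj/funext. Qed.

Lemma c0_bounded (a : A) : exists2 M : R, 0 <= M & forall v, normc (a v) <= M.
Proof.
have fin1 : finite_set [set v | 1 <= `|a v|] by exact: c0_vanishing.
have ge0 v : 0 <= normc (a v) by exact: normc_ge0.
pose B : {fset V} := fset_set [set v | 1 <= `|a v|].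
exists (1 + \sum_(v <- B) normc (a v)) => [|v]; first by rewrite addr_ge0// sumr_ge0.
have [vB|vB] := boolP (v \in B).
  by rewrite (big_fsetD1 v)//= addrCA lerDl addr_ge0// sumr_ge0.
apply: (@le_trans _ _ 1); last by rewrite lerDl sumr_ge0.
have nle : ~ (1 <= `|a v|).
  by move=> av; case/negP: vB; rewrite in_fset_set//; exact: mem_set.
rewrite leNgt; apply/negP => lt1; apply: nle.
have : 1%:C%C <= (normc (a v))%:C%C :> R[i] by rewrite lecR ltW.
by [].
Qed.

Lemma graph_vector_mul (x : graph_corr) (a : A) (g : edge E -> V) :
  (fun e => x e * a (g e) : R[i]^o) \in graph_vector_pred.
Proof.
apply/asboolP; have [M M0 aM] := c0_bounded a.
apply: (graph_vector_dom (sqr_ge0 M) (gc_vectorP x) is_graph_vector0) => e.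
rewrite Normc.normc0 expr0n mulr0 addr0 Normc.normcM exprMn mulrC.
by rewrite ler_wpM2r ?sqr_ge0// ler_sqr ?nnegrE// normc_ge0.
Qed.

Definition gc_ract (x : graph_corr) (a : A) : graph_corr :=
  MkGraphCorr (graph_vector_mul x a (@src E)).

Lemma gc_lact_subproof (a : A) (x : graph_corr) :
  (fun e => a (rng e) * x e : R[i]^o) \in graph_vector_pred.
Proof.
have := graph_vector_mul x a (@rng E).
by under eq_fun do rewrite mulrC.
Qed.
Definition gc_lact (a : A) (x : graph_corr) : graph_corr :=
  MkGraphCorr (gc_lact_subproof a x).

Lemma gc_inner_bound (x y : graph_corr) (v : V) :
  `|usum (fiber v) (fun e => (x e : R[i])^* * (y e : R[i]))|
    <= `|(fine (xhat x v))%:C%C| + `|(fine (xhat y v))%:C%C|.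
Proof.
rewrite !xhat_fine_norm /usum; case: xgetP => [l _ /= hl|_]; last first.
  by rewrite normr0 addr_ge0// ler0c fine_ge0// xhat_ge0.
rewrite -rmorphD /= (normr_normc l) lecR.
apply/ler_addgt0Pr => eps eps0.
have [|B sB hB] := hl eps%:C%C; first by rewrite ltcR.
have {hB} := hB B sB (@subset_refl _ B).
set s := \sum_(e \in B) _ => sl.
have sl' : normc (s - l) < eps by rewrite -ltcR.
have ls : normc l <= normc s + normc (s - l).
  rewrite -[in leLHS](subKr s l) (le_trans (le_normcD _ _))//.
  by rewrite normcN.
apply: (le_trans ls); apply: lerD; last exact: ltW.
have fin_term (z : graph_corr) : \sum_(e \in B) normc (z e) ^+ 2 <= fine (xhat z v).
  rewrite -lee_fin fineK ?xhat_fin//; last exact: gc_vectorP.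
  by rewrite -fsumEFin; [apply: ereal_sup_ubound; exists B|case: sB].
have ssum : normc s <= \sum_(e \in B) (normc (x e) ^+ 2 + normc (y e) ^+ 2).
  rewrite -lecR -normr_normc /s; have [finB _] := sB; rewrite !fsbig_finite//=.
  rewrite rmorph_sum /= (le_trans (ler_norm_sum _ _ _))//.
  apply: ler_sum => e _; rewrite normrM norm_conjC.
  rewrite !normr_normc -rmorphM lecR.
  have := sqr_ge0 (normc (x e) - normc (y e)).
  have := normc_ge0 (x e); have := normc_ge0 (y e).
  by nra.
apply: (le_trans ssum); rewrite fsbig_split/=; last by case: sB.
by apply: lerD.
Qed.

Lemma gc_inner_subproof (x y : graph_corr) :
  (fun v => usum (fiber v) (fun e => (x e : R[i])^* * (y e : R[i])) : R[i]^o)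
    \in @vanishing_pred R V.
Proof.
apply/asboolP; apply: (vanishing_add (gc_vectorP x).2 (gc_vectorP y).2) => v.
exact: gc_inner_bound.
Qed.
Definition gc_inner (x y : graph_corr) : A := MkC0 (gc_inner_subproof x y).

Lemma gc_delta_subproof (e0 : edge E) :
  (fun e => (e == e0)%:R : R[i]^o) \in graph_vector_pred.
Proof.
have hat_le v : (xhat (fun e => (e == e0)%:R) v <= (src e0 == v)%:R%:E)%E.
  apply: ge_ereal_sup => _ [B [finB sB] <-].
  rewrite fsumEFin// lee_fin fsbig_finite//=.
  have [e0B|e0B] := boolP (e0 \in fset_set B).
    rewrite (big_fsetD1 e0)//= eqxx Normc.normc1 expr1n big1_fset ?addr0.
      move: e0B; rewrite in_fset_set// inE => /sB/= ->.
      by rewrite eqxx.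
    move=> e; rewrite !inE => /andP[/negbTE -> _] _.
    by rewrite Normc.normc0 expr0n.
  rewrite big1_fset// => e eB _; case: eqP => [ee|_].
    by move: e0B; rewrite -ee eB.
  by rewrite Normc.normc0 expr0n.
apply/asboolP; split=> [v|eps eps0].
  by apply: le_lt_trans (hat_le v) _; rewrite ltry.
apply: sub_finite_set (finite_set1 (src e0)) => v /=.
rewrite xhat_fine_norm; case: eqP (hat_le v) => [->//|_ h0].
have -> : xhat (fun e => (e == e0)%:R) v = 0%E.
  by apply/eqP; rewrite eq_le h0 xhat_ge0.
by rewrite lt_geF.
Qed.
Definition gc_delta (e0 : edge E) : graph_corr := MkGraphCorr (gc_delta_subproof e0).

End GraphCorrespondence.

Definition star_hom (R : realType) (A B : starAlgType R) (f : A -> B) : Prop :=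
  [/\ linear f, {morph f : a b / amul a b} & {morph f : a / star a}].

Lemma star_hom_comp (R : realType) (A B C : starAlgType R)
    (g : B -> C) (f : A -> B) :
  star_hom g -> star_hom f -> star_hom (g \o f).
Proof.
move=> [gl gM gs] [fl fM fs]; split => [c a b|a b|a] /=.
- by rewrite fl gl.
- by rewrite fM gM.
- by rewrite fs gs.
Qed.

Section Toeplitz.
Variables (R : realType) (E : graph).

Definition toeplitz_representation (B : cstarAlgType R)
    (sigma : graph_corr R E -> B) (pi : C0 R (vertex E) -> B) : Prop :=
  [/\ linear sigma, star_hom pi,
      forall x a, sigma (gc_ract x a) = amul (sigma x) (pi a),
      forall a x, sigma (gc_lact a x) = amul (pi a) (sigma x) &
      forall x y, pi (gc_inner x y) = amul (star (sigma x)) (sigma y)].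

(* T_{X(E)} is determined up to canonical isomorphism by this universal
   property, so statements quantify over an arbitrary model of it. *)
Record toeplitz_algebra := ToeplitzAlgebra {
  ta_alg :> cstarAlgType R;
  ta_sigma : graph_corr R E -> ta_alg;
  ta_pi : C0 R (vertex E) -> ta_alg;
  ta_rep : toeplitz_representation ta_sigma ta_pi;
  ta_univ : forall (B : cstarAlgType R)
      (sigma : graph_corr R E -> B) (pi : C0 R (vertex E) -> B),
    toeplitz_representation sigma pi ->
    exists! rho : ta_alg -> B,
      [/\ star_hom rho, sigma = rho \o ta_sigma & pi = rho \o ta_pi]
}.

Definition ta_edge (T : toeplitz_algebra) (e : edge E) : T :=
  ta_sigma T (gc_delta R e).
Definition ta_vertex (T : toeplitz_algebra) (v : vertex E) : T :=
  ta_pi T (c0_delta R v).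

End Toeplitz.

Section CoherentUnitaryEquivalence.
Variables (R : realType) (E F : graph).

Definition coherent_unitary_equivalence (U : graph_corr R E -> graph_corr R F)
    (alpha : C0 R (vertex E) -> C0 R (vertex F)) : Prop :=
  [/\ linear U, star_hom alpha, bijective alpha &
   exists Uinv : graph_corr R F -> graph_corr R E,
     [/\ cancel U Uinv, cancel Uinv U,
         forall x a, U (gc_ract x a) = gc_ract (U x) (alpha a),
         forall a x, U (gc_lact a x) = gc_lact (alpha a) (U x) &
         forall x y, gc_inner (U x) y = alpha (gc_inner x (Uinv y))]].

Lemma coherent_toeplitz U alpha (TF : toeplitz_algebra R F) :
  coherent_unitary_equivalence U alpha ->
  toeplitz_representation (ta_sigma TF \o U) (ta_pi TF \o alpha).
Proof.
move=> [Ul al _ [Ui [UK _ Ur Uleft Uin]]].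
have [sl pl sr sleft sin] := ta_rep TF.
split=> [c x y||x a|a x|x y] /=.
- by rewrite Ul sl.
- exact: star_hom_comp.
- by rewrite Ur sr.
- by rewrite Uleft sleft.
- by rewrite -sin Uin UK.
Qed.

Definition Gamma (TE : toeplitz_algebra R E) (TF : toeplitz_algebra R F)
    U alpha (UA : coherent_unitary_equivalence U alpha) : TE -> TF :=
  sval (cid (ta_univ TE (coherent_toeplitz TF UA))).

Arguments Gamma TE TF {U alpha} UA.

Lemma GammaP TE TF U alpha (UA : coherent_unitary_equivalence U alpha) :
  [/\ star_hom (Gamma TE TF UA),
      ta_sigma TF \o U = Gamma TE TF UA \o ta_sigma TE &
      ta_pi TF \o alpha = Gamma TE TF UA \o ta_pi TE].
Proof. by have [] := svalP (cid (ta_univ TE (coherent_toeplitz TF UA))). Qed.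

Lemma Gamma_edge TE TF U alpha (UA : coherent_unitary_equivalence U alpha) e :
  Gamma TE TF UA (ta_edge TE e) = ta_sigma TF (U (gc_delta R e)).
Proof.
have [_ GU _] := GammaP TE TF UA.
exact: esym (congr1 (fun f => f (gc_delta R e)) GU).
Qed.

Lemma Gamma_vertex TE TF U alpha (UA : coherent_unitary_equivalence U alpha) v :
  Gamma TE TF UA (ta_vertex TE v) = ta_pi TF (alpha (c0_delta R v)).
Proof.
have [_ _ Ga] := GammaP TE TF UA.
exact: esym (congr1 (fun f => f (c0_delta R v)) Ga).
Qed.

End CoherentUnitaryEquivalence.
Arguments Gamma {R E F} TE TF {U alpha} UA.

Lemma coherent_inv (R : realType) (E F : graph) U alpha :
  @coherent_unitary_equivalence R E F U alpha ->
  exists Ui ai, [/\ @coherent_unitary_equivalence R F E Ui ai,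
    cancel U Ui, cancel Ui U, cancel alpha ai & cancel ai alpha].
Proof.
move=> [Ul [al aM ast] [ai aK aiK] [Ui [UK UiK Ur Uleft Uin]]].
exists Ui, ai; split=> //; split.
- by move=> c x y; apply: (can_inj UK); rewrite Ul !UiK.
- split=> [c a b|a b|a]; apply: (can_inj aK).
  + by rewrite al !aiK.
  + by rewrite aM !aiK.
  + by rewrite ast !aiK.
- by exists alpha.
- exists U; split=> // [x a|a x|x y].
  + by apply: (can_inj UK); rewrite Ur !UiK aiK.
  + by apply: (can_inj UK); rewrite Uleft !UiK aiK.
  + by apply: (can_inj aK); rewrite aiK -{2}(UiK x) Uin UK.
Qed.

Lemma toeplitz_endo_id (R : realType) (E : graph) (T : toeplitz_algebra R E)
    (rho : T -> T) : star_hom rho ->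
  rho \o ta_sigma T = ta_sigma T -> rho \o ta_pi T = ta_pi T -> rho =1 id.
Proof.
move=> rhoh rs rp t; have [r0 [_ uniq]] := ta_univ T (ta_rep T).
have <- : r0 = rho by apply: uniq; split.
by have -> : r0 = id by apply: uniq; split.
Qed.

Lemma Gamma_bij (R : realType) (E F : graph) (TE : toeplitz_algebra R E)
    (TF : toeplitz_algebra R F) U alpha
    (UA : coherent_unitary_equivalence U alpha) :
  bijective (Gamma TE TF UA).
Proof.
have [Ui [ai [UAi UK UiK aK aiK]]] := coherent_inv UA.
have [h1 s1 p1] := GammaP TE TF UA; have [h2 s2 p2] := GammaP TF TE UAi.
exists (Gamma TF TE UAi).
  apply: (toeplitz_endo_id (star_hom_comp h2 h1)).
    by rewrite -compA -s1 compA -s2; apply/funext => x /=; rewrite UK.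
  by rewrite -compA -p1 compA -p2; apply/funext => x /=; rewrite aK.
apply: (toeplitz_endo_id (star_hom_comp h1 h2)).
  by rewrite -compA -s2 compA -s1; apply/funext => x /=; rewrite UiK.
by rewrite -compA -p2 compA -p1; apply/funext => x /=; rewrite aiK.
Qed.

Section Representations.
Variables (R : realType) (H : hilbertType R).

Definition bounded_operator (T : H -> H) : Prop :=
  linear T /\ exists M : R[i], forall h, `|T h| <= M * `|h|.

(* The last clause says that tau (star a) is the Hilbert space adjoint of
   tau a. *)
Definition star_representation (A : starAlgType R) (tau : A -> H -> H) : Prop :=
  [/\ forall a, bounded_operator (tau a),
      forall (c : R[i]) a b h, tau (c *: a + b) h = c *: tau a h + tau b h,
      forall a b, tau (amul a b) = tau a \o tau b &
      forall a h k, hdot (tau (star a) h) k = hdot h (tau a k)].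

Definition faithful_rep (A : starAlgType R) (tau : A -> H -> H) : Prop :=
  injective tau.

Definition nondegenerate_rep (A : starAlgType R) (tau : A -> H -> H) : Prop :=
  closure [set h | exists (n : nat) (a : 'I_n -> A) (k : 'I_n -> H),
    h = \sum_(i < n) tau (a i) (k i)] = [set: H].

Definition commutant (S : set (H -> H)) : set (H -> H) :=
  [set w | bounded_operator w /\ forall t, S t -> w \o t = t \o w].

Definition vertex_commutant (E : graph) (T : toeplitz_algebra R E)
    (tau : T -> H -> H) : set (H -> H) :=
  commutant (range (tau \o ta_vertex T)).

(* Pointwise convergence on H is convergence in the strong operator topology;
   tau (star (ta_edge T e)) is the adjoint of tau (ta_edge T e). *)
Definition Ad (E : graph) (T : toeplitz_algebra R E) (tau : T -> H -> H)
    (w : H -> H) : H -> H :=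
  fun h => usum [set: edge E]
    (fun e => tau (ta_edge T e) (w (tau (star (ta_edge T e)) h))).

End Representations.

(* Main.v *)
(* Write P_v, Q_w for the images of the vertices of E and F on H, and S_e, T_f
   for those of the edges. They are nonzero because some Toeplitz representation
   kills no vertex, and the P_v (resp. Q_w) have no common kernel because the
   representations are nondegenerate. An operator that commutes with
   W = {P_v}' = {Q_w}' and lives under one Q_w commutes with all rank one
   operators on the range of Q_w, so it is a scalar multiple of Q_w; applied to
   P_v Q_w this shows that each Q_w is a P_v, which gives alpha.
   For x in X(E) one has Ad(w) sigma(x) = sigma(x) w and T_f^* Ad(w) = w T_f^*
   for w in W, so T_f^* sigma(x) commutes with W and equals c_f Q_{s(f)}. Since
   Ad(1) sigma(x) = sigma(x), the vector c = (c_f) of X(F) has the same image as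
   x, and U x = c defines U. Hence alpha and U intertwine the two injective
   representations, from which all their properties follow. *)

Require Import Defs.
From HB Require Import structures.
From mathcomp Require Import all_boot all_order all_algebra finmap.
From mathcomp Require Import complex ring lra.
From mathcomp Require Import all_classical reals ereal topology normedtype esum.

Set Implicit Arguments.
Unset Strict Implicit.
Unset Printing Implicit Defensive.

Import Order.TTheory GRing.Theory Num.Theory.
Import numFieldNormedType.Exports.

Local Open Scope classical_set_scope.
Local Open Scope fset_scope.
Local Open Scope ring_scope.

(** * Unordered sums *)

(** The Toeplitz algebra is given only by a universal property whose targets are C*-algebras. Hence
    the bounded operators on [H] are made into a C*-algebra [BH] and the representations are lifted
    into it; square summable families supply a Hilbert space for a representation that kills no
    vertex. Density of the algebra spanned by the generators is not part of the data, so statements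
    about all its elements come from two homomorphisms that agree on the generators: this yields
    both the absence of a common kernel and the final identity of the representations. The other
    obstacle is analytic. [usum] is 0 on a divergent family, so the inner product of X(E) and the
    sums [Ad] obey no law until summability is shown, by a Cauchy criterion for nets. Contractivity
    of the homomorphisms on C_0 is derived from a square root; together with the vanishing of [xhat]
    at infinity it makes each sigma(x) a norm limit of finite combinations of the S_e, which carries
    identities from point masses to arbitrary vectors. *)

Section UnorderedSums.
Variables (K : numFieldType) (V : normedZmodType K) (I : choiceType).
Implicit Types (D : set I) (f : I -> V).

(** Replaces classical finite sets by [{fset I}] and moves [D] into the filter of the sum, so that
    [B] may be any finite superset of [A], inside [D] or not. *)
Lemma has_sumP D f l : has_sum D f l <->
  forall eps : K, 0 < eps -> exists A : {fset I}, forall B : {fset I},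
    A `<=` B -> `|\sum_(i <- B | i \in D) f i - l| < eps.
Proof.
split=> hl eps eps0; have [A] := hl eps eps0.
  move=> [finA AD] hA; exists (fset_set A) => B AB.
  have := hA [set` [fset i in B | i \in D]]; rewrite fsbig_finite//= set_fsetK.
  rewrite big_fset /=; apply=> [|i Ai]; last first.
    rewrite /= !inE; apply/andP; split; last exact/mem_set/AD.
    by apply: (fsubsetP AB); rewrite in_fset_set//; exact/mem_set.
  by split=> // i; rewrite /= !inE => /andP[_]; rewrite inE.
move=> hA; exists [set` [fset i in A | i \in D]].
  by split=> // i; rewrite /= !inE => /andP[_]; rewrite inE.
move=> B [finB BD] AB; rewrite fsbig_finite//=.
have := hA (A `|` fset_set B) (fsubsetUl _ _); rewrite big_fset_condE /=.
suff -> : [fset i | i in A `|` fset_set B & i \in D] = fset_set B by [].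
apply/fsetP => i; rewrite !inE /= in_fset_set//.
apply/andP/idP => [[/orP[iA iD|//]]|iB].
  by apply/mem_set/AB; rewrite /= !inE iA.
by split; [rewrite iB orbT|apply/mem_set/BD/set_mem].
Qed.

Lemma has_sum_unique D f l m : has_sum D f l -> has_sum D f m -> l = m.
Proof.
move=> /has_sumP hl /has_sumP hm; apply/eqP; rewrite -subr_eq0 -normr_eq0.
apply/negPn/negP => lm.
have lm0 : 0 < `|l - m| / 2 by rewrite divr_gt0// normr_gt0 -normr_eq0.
have [A hA] := hl _ lm0; have [B hB] := hm _ lm0.
have := ltrD (hA _ (fsubsetUl A B)) (hB _ (fsubsetUr A B)).
rewrite -splitr distrC => /(le_lt_trans (ler_normD _ _)).
by rewrite addrA subrK ltxx.
Qed.

Lemma usumE D f l : has_sum D f l -> usum D f = l.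
Proof.
by move=> hl; rewrite /usum; case: xgetP => [m _ /has_sum_unique/(_ hl)//|/(_ l)].
Qed.

Lemma has_sum_fset D f (A : {fset I}) :
  (forall i, D i -> i \notin A -> f i = 0) ->
  has_sum D f (\sum_(i <- A | i \in D) f i).
Proof.
move=> f0; apply/has_sumP => eps eps0; exists A => B AB.
rewrite big_fset_condE [X in _ - X]big_fset_condE.
rewrite [X in X - _](_ : _ = \sum_(i <- [fset x in A | x \in D]) f i) ?subrr ?normr0//.
apply/esym; apply: big_fset_incl => [|i].
  apply/fsubsetP => i; rewrite !inE /= => /andP[iA ->].
  by rewrite (fsubsetP AB).
rewrite !inE /= => /andP[iB iD]; rewrite iD andbT => iA.
by apply: f0 => //; exact/set_mem.
Qed.

Lemma has_sum0 D f : (forall i, D i -> f i = 0) -> has_sum D f 0.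
Proof.
move=> f0; rewrite -[0](big_seq_fset0 +%R f).
have := @has_sum_fset D f fset0; rewrite !big_seq_fsetE !big_fset0.
by apply=> i Di _; exact: f0.
Qed.

Lemma has_sum_single D f i0 : D i0 -> (forall i, D i -> i != i0 -> f i = 0) ->
  has_sum D f (f i0).
Proof.
move=> Di0 f0; have := @has_sum_fset D f [fset i0].
rewrite big_mkcond big_seq_fset1 mem_set//; apply=> i Di.
by rewrite inE => ii0; exact: f0.
Qed.

End UnorderedSums.

(** Injectivity of [h] makes preimages of finite sets finite, so a finite set on either side is
    matched by one on the other side with the same partial sum; indices outside the image contribute
    0. *)
Lemma has_sum_reindex (K : numFieldType) (V : normedZmodType K)
    (I J : choiceType) (h : I -> J) (D : set I) (D' : set J)
    (f : I -> V) (g : J -> V) l :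
  injective h -> (forall i, D i -> D' (h i)) -> (forall i, D i -> g (h i) = f i) ->
  (forall j, D' j -> ~ (h @` D)%classic j -> g j = 0) ->
  has_sum D f l <-> has_sum D' g l.
Proof.
move=> hI hD gf g0.
have sumE (A : {fset I}) (B : {fset J}) :
    (forall i, D i -> (i \in A) = (h i \in B)) ->
    \sum_(i <- A | i \in D) f i = \sum_(j <- B | j \in D') g j.
  move=> AB; rewrite big_fset_condE [RHS]big_fset_condE.
  rewrite (@eq_fbigr _ _ _ _ _ _ _ (g \o h)); last first.
    by move=> i; rewrite !inE /= => /andP[_ /set_mem Di] _; rewrite /= gf.
  transitivity (\sum_(j <- (h @` [fset i in A | i \in D])%fset) g j).
    by rewrite [RHS]big_imfset//= => ? ? _ _; exact: hI.
  apply: big_fset_incl => [|j].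
    apply/fsubsetP => j; case/imfsetP => i /=.
    rewrite !inE /= => /andP[iA /set_mem Di] ->.
    by rewrite -AB// iA; exact/mem_set/hD.
  rewrite !inE /= => /andP[jB /set_mem Dj] /imfsetP jh; apply: g0 => // -[i Di ij].
  by apply: jh; exists i; rewrite // !inE /= AB// ij jB; exact/mem_set.
split=> /has_sumP hl; apply/has_sumP => eps eps0; have [A hA] := hl eps eps0.
  exists (h @` A)%fset => B AB.
  pose A' := fset_set [set i | h i \in B].
  have finA' : finite_set [set i | h i \in B].
    by apply: (finite_preimage (f := h) _ (finite_fset B)) => ? ? _ _; exact: hI.
  rewrite -(sumE A')//; last by move=> i _; rewrite in_fset_set// mem_setE.
  apply: hA; apply/fsubsetP => i iA; rewrite in_fset_set//; apply/mem_set.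
  by apply: (fsubsetP AB); exact: in_imfset.
pose A' := fset_set [set i | h i \in A].
have finA' : finite_set [set i | h i \in A].
  by apply: (finite_preimage (f := h) _ (finite_fset A)) => ? ? _ _; exact: hI.
exists A' => B AB.
rewrite (sumE B (A `|` (h @` B))%fset)//; first by apply: hA; exact: fsubsetUl.
move=> i Di; rewrite inE mem_imfset//=.
apply/idP/idP => [->|/orP[iA|//]]; first by rewrite orbT.
by apply: (fsubsetP AB); rewrite in_fset_set//; exact/mem_set.
Qed.

(** Completeness enters as a hypothesis on filters so that the criterion serves both [R[i]^o],
    through [complex_complete], and Hilbert spaces. The filter [F] consists of the sets that contain
    a tail of the net of partial sums. *)
Lemma cauchy_has_sum (K : numFieldType) (V : normedModType K)
    (I : choiceType) (D : set I) (f : I -> V) :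
  (forall F : set_system V, ProperFilter F -> cauchy F -> cvg F) ->
  (forall eps : K, 0 < eps -> exists A : {fset I}, forall B : {fset I},
    [disjoint A & B] -> `|\sum_(i <- B | i \in D) f i| < eps) ->
  exists l, has_sum D f l.
Proof.
move=> cmpl hf; pose s (B : {fset I}) := \sum_(i <- B | i \in D) f i.
pose F : set_system V := [set P | exists A, forall B, A `<=` B -> P (s B)].
have FF : ProperFilter F.
  split; first by move=> [A /(_ A (fsubset_refl A))].
  split.
  - by exists fset0.
  - move=> P Q [A hA] [B hB]; exists (A `|` B) => C ABC; split.
      by apply: hA; exact: fsubset_trans (fsubsetUl _ _) ABC.
    by apply: hB; exact: fsubset_trans (fsubsetUr _ _) ABC.
  - by move=> P Q PQ [A hA]; exists A => B AB; exact/PQ/hA.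
have : cauchy F.
  apply: cauchy_exP => eps eps0; have [A hA] := hf eps eps0.
  exists (s A), A => B AB; rewrite -ball_normE /ball_ /= distrC.
  rewrite /s (big_fsetIDcond _ (mem A)) /= [X in X + _ - _](_ : _ = s A).
    rewrite addrC addKr; apply: hA; apply/fdisjointP => i iA.
    by rewrite !inE /= iA andbF.
  apply: eq_fbigl_cond => i; rewrite !inE /=.
  by case: (boolP (i \in A)) => [/(fsubsetP AB) ->|]; rewrite ?andbF.
move=> /(cmpl F FF) /cvg_ex[l Fl]; exists l; apply/has_sumP => eps eps0.
have [A hA] : F (ball l eps) by apply: Fl; exact: nbhsx_ballx.
by exists A => B /hA; rewrite -ball_normE /ball_ /= distrC.
Qed.

Section ComplexComplete.
Variable R : realType.

Lemma complex_norm_le (z : R[i]) (e : R) : `|complex.Re z| < e / 2 ->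
  `|complex.Im z| < e / 2 -> `|z| < e%:C%C.
Proof.
move=> re im; rewrite (complexE z) (le_lt_trans (ler_normD _ _))// normrM.
have -> : `|'i%C : R[i]| = 1 by rewrite complexiE normCi.
rewrite mul1r !normr_normc -rmorphD ltcR [e]splitr.
have nc (x : R) : Normc.normc x%:C%C = `|x|.
  by rewrite /= expr0n addr0 sqrtr_sqr.
by rewrite !nc ltrD.
Qed.

Lemma normr_Re_Im (z : R[i]) (e : R) : `|z| < e%:C%C ->
  `|complex.Re z| < e /\ `|complex.Im z| < e.
Proof.
rewrite normr_normc ltcR => ze; split; apply: le_lt_trans ze; case: z => a b /=.
  by rewrite -sqrtr_sqr ler_wsqrtr// lerDl sqr_ge0.
by rewrite -sqrtr_sqr ler_wsqrtr// lerDr sqr_ge0.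
Qed.

Lemma complex_complete (F : set_system R[i]^o) :
  ProperFilter F -> cauchy F -> cvg F.
Proof.
move=> FF /(cauchyP _) Fc.
have part (g : R[i]^o -> R) :
    (forall z w e, `|z - w| < e%:C%C -> `|g z - g w| < e) -> cvg (g @ F).
  move=> gle; have gF : ProperFilter (g @ F) by apply: fmap_proper_filter.
  apply: cauchy_cvg; apply: cauchy_exP => e e0.
  have [|z Fz] := Fc e%:C%C; first by rewrite ltcR.
  exists (g z); apply: (@filterS _ F _ (ball z e%:C%C)) => //= w.
  rewrite -!ball_normE /ball_ /=; exact: gle.
have /cvg_ex[a Fa] : cvg ((@complex.Re R : R[i]^o -> R) @ F).
  by apply: part => -[z1 z2] [w1 w2] e /normr_Re_Im[].
have /cvg_ex[b Fb] : cvg ((@complex.Im R : R[i]^o -> R) @ F).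
  by apply: part => -[z1 z2] [w1 w2] e /normr_Re_Im[].
apply/cvg_ex; exists (Complex a b); apply/cvg_ballP => -[e e'] e0.
(* The order of [R[i]] only compares numbers with equal imaginary parts, so a positive [e] is
   real. *)
have ee' : e' = 0 by move: e0; rewrite ltcE /= => /andP[/eqP].
rewrite {}ee' in e0 *.
have {}e0 : 0 < e / 2 by rewrite divr_gt0//; move: e0; rewrite ltcE => /andP[].
move/cvg_ballP : Fa => /(_ _ e0) Fa; move/cvg_ballP : Fb => /(_ _ e0) Fb.
near=> z; rewrite -ball_normE /ball_ /=.
apply: complex_norm_le.
  have : ball a (e / 2) (complex.Re z) by near: z; exact: Fa.
  by rewrite -ball_normE /ball_; case: (z).
have : ball b (e / 2) (complex.Im z) by near: z; exact: Fb.
by rewrite -ball_normE /ball_; case: (z).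
Unshelve. all: by end_near. Qed.

End ComplexComplete.

(** A finite set whose sum comes within [eps] of the supremum of all finite sums leaves less than
    [eps] for any set disjoint from it. *)
Lemma small_tails (R : realType) (I : choiceType) (g : I -> R) (M : R) :
  (forall i, 0 <= g i) -> (forall B : {fset I}, \sum_(i <- B) g i <= M) ->
  forall eps, 0 < eps -> exists A : {fset I}, forall B : {fset I},
    [disjoint A & B] -> \sum_(i <- B) g i < eps.
Proof.
move=> g0 gM eps eps0.
pose X := [set \sum_(i <- B) g i | B in [set: {fset I}]]%classic.
have supX : has_sup X.
  split; first by exists (\sum_(i <- fset0) g i), fset0.
  by exists M => _ [B _ <-].
have [_ [A _ <-] hA] := sup_adherent eps0 supX.
exists A => B AB.
have : \sum_(i <- A `|` B) g i <= sup X by apply: sup_upper_bound => //; exists (A `|` B).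
rewrite (big_fsetID _ (mem A)) /=.
have -> : [fset x in A `|` B | x \in A] = A.
  by apply/fsetP => i; rewrite !inE /=; case: (i \in A); rewrite ?andbF.
have -> : [fset x in A `|` B | x \notin A] = B.
  apply/fsetP => i; rewrite !inE /=; have [iA|] := boolP (i \in A) => //=.
    by rewrite (negbTE (fdisjointP AB _ iA)).
  by rewrite andbT.
by move: hA; lra.
Qed.

(** Only additivity is asked of [phi], so that conjugation, which is not linear, is covered as
    well. *)
Lemma has_sum_map (K : numFieldType) (V W : normedZmodType K) (I : choiceType)
    (D : set I) (f : I -> V) (l : V) (phi : V -> W) (M : K) :
  {morph phi : u v / u - v} -> (forall u, `|phi u| <= M * `|u|) ->
  has_sum D f l -> has_sum D (phi \o f) (phi l).
Proof.
move=> phiB phiM /has_sumP hl; apply/has_sumP => eps eps0.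
have phi0 : phi 0 = 0 by rewrite -[X in phi X](subrr 0) phiB subrr.
have phiN u : phi (- u) = - phi u by rewrite -sub0r phiB phi0 sub0r.
have phiD u v : phi (u + v) = phi u + phi v by rewrite -{1}[v]opprK phiB phiN opprK.
have M1 : 0 < `|M| + 1 by rewrite ltr_wpDl.
have [A hA] := hl _ (divr_gt0 eps0 M1); exists A => B /hA; rewrite ltr_pdivlMr// => le.
rewrite -(big_morph phi phiD phi0) -phiB; apply: le_lt_trans le.
set u := _ - l; apply: le_trans (phiM u) _; rewrite mulrC.
have [->|u0] := eqVneq u 0; first by rewrite normr0 !mul0r.
have : 0 <= M * `|u| by apply: le_trans (phiM u).
rewrite pmulr_lge0 ?normr_gt0// => M0; rewrite ger0_norm// ler_wpM2l//.
by rewrite lerDl.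
Qed.

Lemma has_sumD (K : numFieldType) (V : normedZmodType K) (I : choiceType)
    (D : set I) (f g : I -> V) (l m : V) :
  has_sum D f l -> has_sum D g m -> has_sum D (f \+ g) (l + m).
Proof.
move=> /has_sumP hl /has_sumP hm; apply/has_sumP => eps eps0.
have e20 : 0 < eps / 2 by rewrite divr_gt0.
have [A hA] := hl _ e20; have [B hB] := hm _ e20.
exists (A `|` B) => C ABC.
have := ltrD (hA C (fsubset_trans (fsubsetUl _ _) ABC))
  (hB C (fsubset_trans (fsubsetUr _ _) ABC)).
rewrite -splitr => /(le_lt_trans (ler_normD _ _)).
by rewrite addrACA -opprD -big_split.
Qed.

(** * The inner product of a graph correspondence *)

Section InnerProduct.
Variables (R : realType) (E : graph).
Implicit Types (x y z : graph_corr R E) (v : vertex E).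
Local Notation normc := Normc.normc.
Local Notation norm2 x v := (fine (xhat x v)).

Lemma norm2_ge0 x v : 0 <= norm2 x v.
Proof. by rewrite fine_ge0// xhat_ge0. Qed.

Lemma sum_le_norm2 x v (B : {fset edge E}) :
  \sum_(e <- B | e \in fiber v) normc (x e) ^+ 2 <= norm2 x v.
Proof.
rewrite -lee_fin fineK ?xhat_fin//; last exact: gc_vectorP.
rewrite big_fset_condE; apply: ereal_sup_ubound.
exists [set` [fset e in B | e \in fiber v]].
  by split=> // e; rewrite /= !inE => /andP[_]; rewrite inE.
by rewrite fsbig_finite//= set_fsetK sumEFin.
Qed.

(** [xhat] is a supremum of finite sums. As the terms are nonnegative, a finite set that nearly
    attains it controls every larger one, so the supremum is also the limit of the net. *)
Lemma has_sum_norm2 x v :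
  has_sum (fiber v) (fun e => (normc (x e) ^+ 2)%:C%C) (norm2 x v)%:C%C.
Proof.
apply/has_sumP => -[e e']; rewrite ltcE /= => /andP[/eqP -> e0].
have xfin := xhat_fin v (gc_vectorP x).
have [_ [A [finA Av] <-] hA] := ub_ereal_sup_adherent e0 xfin.
have {}hA : (xhat x v - e%:E < \sum_(i \in A) (normc (x i) ^+ 2)%:E)%E := hA.
move: hA; rewrite -{1}(fineK xfin) -EFinB fsbig_finite//= sumEFin lte_fin => hA.
exists (fset_set A) => B AB; rewrite -rmorph_sum -rmorphB /= normr_normc ltcR.
rewrite /= expr0n addr0 sqrtr_sqr distrC ger0_norm ?subr_ge0 ?sum_le_norm2//.
rewrite ltrBlDr -ltrBlDl (lt_le_trans hA)//.
rewrite [leRHS]big_fset_condE [leRHS](big_fsetID _ (fun e => e \in A))/=.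
rewrite [X in X + _](_ : _ = \sum_(i <- fset_set A) normc (x i) ^+ 2).
  by rewrite lerDl sumr_ge0// => i _; exact: sqr_ge0.
apply: eq_fbigl => i; rewrite !inE /= in_fset_set//.
apply/andP/idP => [[]//|iA]; split=> //; apply/andP; split.
  by apply: (fsubsetP AB); rewrite in_fset_set.
exact/mem_set/Av/set_mem.
Qed.

Lemma norm2_tail x v (eps : R) : 0 < eps -> exists A : {fset edge E},
  forall B, [disjoint A & B] -> \sum_(e <- B | e \in fiber v) normc (x e) ^+ 2 < eps.
Proof.
move=> eps0.
have [|B|A hA] := @small_tails R (edge E)
  (fun e => if e \in fiber v then normc (x e) ^+ 2 else 0) (norm2 x v) _ _ eps eps0.
- by move=> e; case: ifP => // _; exact: sqr_ge0.
- by rewrite -big_mkcond sum_le_norm2.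
by exists A => B /hA; rewrite -big_mkcond.
Qed.

(** Rules out the default value of [usum] in [gc_inner]. The product of two moduli is at most the
    sum of their squares, and both square sums have small tails. *)
Lemma gc_inner_has_sum x y v :
  has_sum (fiber v) (fun e => (x e : R[i])^* * (y e : R[i])) (gc_inner x y v).
Proof.
have [|l hl] := @cauchy_has_sum _ R[i]^o (edge E) (fiber v)
   (fun e => (x e : R[i])^* * (y e : R[i])) (@complex_complete R); last first.
  by rewrite [gc_inner _ _ _](usumE hl).
move=> [e e']; rewrite ltcE /= => /andP[/eqP -> e0].
have e20 : 0 < e / 2 by rewrite divr_gt0.
have [A hA] := norm2_tail x v e20; have [B hB] := norm2_tail y v e20.
exists (A `|` B) => C; rewrite fdisjointUX => /andP[/hA Ax /hB By].
apply: (le_lt_trans (ler_norm_sum _ _ _)).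
apply: (@le_lt_trans _ _ (\sum_(i <- C | i \in fiber v)
   (normc (x i) ^+ 2 + normc (y i) ^+ 2)%:C%C)).
  apply: ler_sum => i _; rewrite normrM norm_conjC !normr_normc -rmorphM lecR.
  have := sqr_ge0 (normc (x i) - normc (y i)).
  have := normc_ge0 (x i); have := normc_ge0 (y i).
  by nra.
rewrite -rmorph_sum big_split /= ltcR [e]splitr.
exact: ltrD.
Qed.

Lemma gc_innerDr x y z v : gc_inner x (y + z) v = gc_inner x y v + gc_inner x z v.
Proof.
apply: (has_sum_unique (gc_inner_has_sum _ _ _)).
have := has_sumD (gc_inner_has_sum x y v) (gc_inner_has_sum x z v).
by congr (has_sum _ _ _); apply/funext => e /=; rewrite -mulrDr.
Qed.

Lemma gc_innerZr x c y v : gc_inner x (c *: y) v = c * gc_inner x y v.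
Proof.
apply: (has_sum_unique (gc_inner_has_sum _ _ _)).
have cM (u : R[i]) : `|c * u| <= `|c| * `|u| by rewrite normrM.
have := @has_sum_map _ _ _ _ _ _ _ ( *%R c) `|c| (mulrBr c) cM (gc_inner_has_sum x y v).
by congr (has_sum _ _ _); apply/funext => e /=; rewrite mulrCA.
Qed.

Lemma gc_innerC x y v : gc_inner x y v = (gc_inner y x v : R[i])^*.
Proof.
apply: (has_sum_unique (gc_inner_has_sum _ _ _)).
have cM (u : R[i]) : `|u^*| <= 1 * `|u| by rewrite norm_conjC mul1r.
have := @has_sum_map _ _ _ _ _ _ _ (fun u : R[i] => u^*) 1 (@rmorphB _ _ _) cM
  (gc_inner_has_sum y x v).
by congr (has_sum _ _ _); apply/funext => e /=; rewrite rmorphM /= conjCK mulrC.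
Qed.

Lemma gc_inner_diag x v : gc_inner x x v = (norm2 x v)%:C%C.
Proof.
apply: (has_sum_unique (gc_inner_has_sum _ _ _)).
have := has_sum_norm2 x v.
congr (has_sum _ _ _); apply/funext => e /=.
by rewrite mulrC -normCK normr_normc -rmorphXn.
Qed.

End InnerProduct.

Section Approximation.
Variables (R : realType) (E : graph).
Implicit Types (x y z : graph_corr R E) (v : vertex E).
Local Notation normc := Normc.normc.
Local Notation norm2 x v := (fine (xhat x v)).

Lemma xhat_le_sums (x : edge E -> R[i]) v (M : R) :
  (forall B : {fset edge E}, \sum_(e <- B | e \in fiber v) normc (x e) ^+ 2 <= M) ->
  (xhat x v <= M%:E)%E.
Proof.
move=> xM; apply: ge_ereal_sup => _ [B [finB Bv] <-].
rewrite fsbig_finite//= sumEFin lee_fin; apply: le_trans (xM (fset_set B)).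
rewrite [leRHS]big_fset_condE (_ : [fset i in _ | _] = fset_set B)//.
apply/fsetP => i; rewrite !inE /= in_fset_set//.
by apply/andP/idP => [[]//|iB]; split=> //; exact/mem_set/Bv/set_mem.
Qed.

Lemma norm2_le x v (M : R) :
  (forall B : {fset edge E}, \sum_(e <- B | e \in fiber v) normc (x e) ^+ 2 <= M) ->
  norm2 x v <= M.
Proof.
move=> /xhat_le_sums; rewrite -lee_fin fineK// xhat_fin//; exact: gc_vectorP.
Qed.

Definition gc_trunc (x : edge E -> R[i]) (A : {fset edge E}) : graph_corr R E :=
  \sum_(e <- A) x e *: gc_delta R e.

Lemma gc_truncE (x : edge E -> R[i]) A e : gc_trunc x A e = if e \in A then x e else 0.
Proof.
have -> : gc_trunc x A e = \sum_(i <- A) x i * (e == i)%:R.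
  by rewrite /gc_trunc (@big_morph _ _ (fun y : graph_corr R E => y e) 0 +%R).
have [eA|eA] := boolP (e \in A).
  rewrite (big_fsetD1 e)//= eqxx mulr1 big1_fset ?addr0// => i.
  by rewrite !inE eq_sym => /andP[/negbTE -> _] _; rewrite mulr0.
rewrite big1_fset// => i iA _; case: eqP => [ei|_]; last by rewrite mulr0.
by rewrite ei iA in eA.
Qed.

Lemma gc_subE x y e : (x - y) e = x e - y e.
Proof. by []. Qed.

(** Uniformity in [v] comes from the vanishing of [xhat]: only the finitely many vertices of [Z]
    carry a squared norm of at least [eps], and [A] collects a tail set for each of them. At any
    other vertex all of [x] is already small. *)
Lemma gc_approx x (eps : R) : 0 < eps -> exists A : {fset edge E},
  forall v, norm2 (x - gc_trunc x A) v <= eps.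
Proof.
move=> eps0; have [_ xv] := gc_vectorP x.
have epsC : 0 < eps%:C%C :> R[i] by rewrite ltcR.
have finZ := xv _ epsC; set Z := [set v | _] in finZ.
pose tailP v := cid (norm2_tail x v eps0).
pose A := (\bigcup_(v <- fset_set Z) projT1 (tailP v))%fset.
exists A => v; apply: norm2_le => B.
have restrE e : normc ((x - gc_trunc x A) e) ^+ 2 = if e \in A then 0 else normc (x e) ^+ 2.
  rewrite gc_subE gc_truncE; case: ifP => _; last by rewrite subr0.
  by rewrite subrr Normc.normc0 expr0n.
have [vZ|vZ] := boolP (v \in Z).
  rewrite (eq_bigr (fun e => if e \notin A then normc (x e) ^+ 2 else 0)); last first.
    by move=> e _; rewrite restrE; case: ifP.
  rewrite -big_mkcondr; apply: ltW.
  have := projT2 (tailP v) [fset e in B | e \notin A].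
  rewrite big_fset_condE [X in _ -> X < _]big_fset_condE.
  rewrite (_ : [fset i in [fset e in B | e \notin A] | i \in fiber v] =
     [fset i in B | (i \in fiber v) && (i \notin A)]).
    apply; apply/fdisjointP => e eA; rewrite !inE /= negb_and negbK.
    apply/orP; right; apply/bigfcupP; exists v => //.
    by rewrite andbT in_fset_set.
  by apply/fsetP => e; rewrite !inE /= -andbA [(e \notin A) && _]andbC.
apply: (@le_trans _ _ (norm2 x v)).
  apply: le_trans (sum_le_norm2 x v B); apply: ler_sum => e _.
  by rewrite restrE; case: ifP => // _; exact: sqr_ge0.
rewrite leNgt; apply/negP => lt; case/negP: vZ; apply/mem_set.
rewrite /Z /=; change (eps%:C%C <= `|(norm2 x v)%:C%C| :> R[i]).
by rewrite xhat_fine_norm lecR ltW.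
Qed.

End Approximation.

(** * Hilbert spaces and their bounded operators *)

Section HermitianForm.
Variables (R : realType) (V : lmodType R[i]) (d : V -> V -> R[i]).
Hypothesis dDr : forall x y z, d x (y + z) = d x y + d x z.
Hypothesis dZr : forall c x y, d x (c *: y) = c * d x y.
Hypothesis dC : forall x y, d x y = (d y x)^*.

Lemma formDl x y z : d (x + y) z = d x z + d y z.
Proof. by rewrite dC dDr rmorphD /= -!dC. Qed.

Lemma formZl c x y : d (c *: x) y = c^* * d x y.
Proof. by rewrite dC dZr rmorphM /= -dC. Qed.

Hypothesis d_ge0 : forall x, 0 <= d x x.
Hypothesis d_eq0 : forall x, d x x = 0 -> x = 0.

Lemma form_real x : (d x x)^* = d x x.
Proof. exact/esym/dC. Qed.

Lemma form_CS x y : `|d x y| ^+ 2 <= d x x * d y y.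
Proof.
have [y0|y0] := eqVneq (d y y) 0.
  rewrite (d_eq0 y0) -(scale0r 0) dZr mul0r normr0 expr0n.
  by rewrite mulr_ge0.
(* This vector is [d y y] times the component of [x] orthogonal to [y]; its square is [d y y] times
   the defect in the Cauchy-Schwarz inequality. *)
have := d_ge0 (d y y *: x - d y x *: y).
rewrite -scaleNr !(dDr, dZr, formDl, formZl) rmorphN /= form_real -dC.
rewrite (_ : _ + _ = d y y * (d x x * d y y - d x y * d y x)); last by ring.
by rewrite pmulr_rge0 ?lt_def ?y0 ?d_ge0// subr_ge0 [d y x]dC -normCK.
Qed.

(* Locked, so that unification does not unfold the norm of [l2] below. *)
Definition form_norm x : R[i] := locked (sqrtC (d x x)).

Lemma form_norm_sqr x : d x x = form_norm x ^+ 2.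
Proof. by rewrite /form_norm -lock sqrtCK. Qed.

Lemma form_norm_ge0 x : 0 <= form_norm x.
Proof. by rewrite /form_norm -lock sqrtC_ge0. Qed.

Lemma form_normZ c x : form_norm (c *: x) = `|c| * form_norm x.
Proof.
rewrite /form_norm -!lock dZr formZl mulrA -normCK sqrtCM ?nnegrE ?exprn_ge0//.
by rewrite sqrCK.
Qed.

Lemma form_norm_eq0 x : form_norm x = 0 -> x = 0.
Proof. by rewrite /form_norm -lock => /eqP; rewrite sqrtC_eq0 => /eqP /d_eq0. Qed.

Lemma form_CS_norm x y : `|d x y| <= form_norm x * form_norm y.
Proof.
rewrite -(@ler_pXn2r _ 2) ?nnegrE ?mulr_ge0 ?form_norm_ge0//.
by rewrite exprMn -!form_norm_sqr form_CS.
Qed.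

Lemma form_normD x y : form_norm (x + y) <= form_norm x + form_norm y.
Proof.
rewrite -(@ler_pXn2r _ 2) ?nnegrE ?addr_ge0 ?form_norm_ge0//.
rewrite -form_norm_sqr dDr !formDl !form_norm_sqr sqrrD.
rewrite [leLHS](_ : _ = form_norm x ^+ 2 + (d y x + d x y) + form_norm y ^+ 2); last by ring.
rewrite lerD2r lerD2l; apply: le_trans (_ : `|d y x + d x y| <= _).
  by rewrite real_ler_norm// CrealE rmorphD /= -!dC addrC.
rewrite (le_trans (ler_normD _ _))// mulr2n lerD// ?form_CS_norm//.
by rewrite mulrC form_CS_norm.
Qed.

End HermitianForm.

Section Hilbert.
Variables (R : realType) (H : hilbertType R).
Implicit Types x y z : H.

Lemma hdotDl x y z : hdot (x + y) z = hdot x z + hdot y z.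
Proof. exact: (formDl hdotDr hdotC). Qed.

Lemma hdotZl c x y : hdot (c *: x) y = c^* * hdot x y.
Proof. exact: (formZl hdotZr hdotC). Qed.

Lemma hdot0r x : hdot x 0 = 0.
Proof. by rewrite -(scale0r 0) hdotZr mul0r. Qed.

Lemma hdot0l x : hdot 0 x = 0.
Proof. by rewrite hdotC hdot0r rmorph0. Qed.

Lemma hdotNr x y : hdot x (- y) = - hdot x y.
Proof. by rewrite -scaleN1r hdotZr mulN1r. Qed.

Lemma hdotNl x y : hdot (- x) y = - hdot x y.
Proof. by rewrite hdotC hdotNr rmorphN /= -hdotC. Qed.

Lemma hdotBr x y z : hdot x (y - z) = hdot x y - hdot x z.
Proof. by rewrite hdotDr hdotNr. Qed.

Lemma hdotBl x y z : hdot (x - y) z = hdot x z - hdot y z.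
Proof. by rewrite hdotDl hdotNl. Qed.

Lemma hdot_sumr (I : Type) (s : seq I) (P : pred I) (f : I -> H) x :
  hdot x (\sum_(i <- s | P i) f i) = \sum_(i <- s | P i) hdot x (f i).
Proof. by apply: (big_morph (hdot x)) => [y z|]; rewrite ?hdotDr ?hdot0r. Qed.

Lemma hdot_suml (I : Type) (s : seq I) (P : pred I) (f : I -> H) x :
  hdot (\sum_(i <- s | P i) f i) x = \sum_(i <- s | P i) hdot (f i) x.
Proof.
by apply: (big_morph (fun y => hdot y x)) => [y z|]; rewrite ?hdotDl ?hdot0l.
Qed.

Lemma hdot_eq0 x : hdot x x = 0 -> x = 0.
Proof. by rewrite hdot_norm => /eqP; rewrite expf_eq0 normr_eq0 => /eqP. Qed.

Lemma hdot_ge0 x : 0 <= hdot x x.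
Proof. by rewrite hdot_norm exprn_ge0. Qed.

Lemma hdot_CS x y : `|hdot x y| <= `|x| * `|y|.
Proof.
rewrite -(@ler_pXn2r _ 2) ?nnegrE ?mulr_ge0//.
rewrite exprMn -!hdot_norm; apply: form_CS; first exact: hdotDr.
- exact: hdotZr.
- exact: hdotC.
- exact: hdot_ge0.
- exact: hdot_eq0.
Qed.

Lemma hdot_inj x y : (forall z, hdot z x = hdot z y) -> x = y.
Proof.
by move=> xy; apply/eqP; rewrite -subr_eq0; apply/eqP/hdot_eq0; rewrite hdotBr xy subrr.
Qed.

Lemma pythagoras (I : choiceType) (B : {fset I}) (f : I -> H) :
  (forall i j, i != j -> hdot (f i) (f j) = 0) ->
  `|\sum_(i <- B) f i| ^+ 2 = \sum_(i <- B) `|f i| ^+ 2.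
Proof.
move=> fo; rewrite -hdot_norm hdot_suml; apply: eq_fbigr => i iB _.
rewrite hdot_sumr (big_fsetD1 i)//= big1_fset ?addr0 ?hdot_norm// => j.
by rewrite !inE eq_sym => /andP[/fo].
Qed.

End Hilbert.

(** * The C*-algebra of bounded operators on a Hilbert space *)

Section BoundedOperators.
Variables (R : realType) (H : hilbertType R).

Definition adjoint_of (S T : H -> H) := forall h k, hdot (S h) k = hdot h (T k).

Lemma adjoint_ofC S T : adjoint_of S T -> adjoint_of T S.
Proof. by move=> ST h k; rewrite hdotC -ST -hdotC. Qed.

Lemma adjoint_linear S T : adjoint_of S T -> linear T.
Proof.
by move=> ST c x y; apply: hdot_inj => z; rewrite -ST !(hdotDr, hdotZr) -!ST.
Qed.

Lemma adjoint_unique S S' T : adjoint_of S T -> adjoint_of S' T -> S =1 S'.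
Proof.
move=> /adjoint_ofC ST /adjoint_ofC ST' h.
by apply: hdot_inj => k; rewrite -ST -ST'.
Qed.

Definition op_bound (T : H -> H) (m : R) :=
  0 <= m /\ forall h, `|T h| <= m%:C%C * `|h|.

Lemma normrR (V : normedZmodType R[i]) (x : V) : `|x| = (complex.Re `|x|)%:C%C.
Proof. by rewrite RRe_real// normr_real. Qed.

Lemma op_boundP T (M : R[i]) : (forall h, `|T h| <= M * `|h|) ->
  op_bound T (Normc.normc M).
Proof.
move=> TM; split=> [|h]; first exact: normc_ge0.
have M0 := le_trans (normr_ge0 _) (TM h).
by rewrite -normr_normc -[X in _ <= _ * X]normr_id -normrM ger0_norm.
Qed.

Lemma adjoint_bound S T m : adjoint_of S T -> op_bound T m -> op_bound S m.
Proof.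
move=> ST [m0 Tm]; split=> // h.
have [->|Sh0] := eqVneq (S h) 0; first by rewrite normr0 mulr_ge0// ler0c.
rewrite -(@ler_pM2l _ `|S h|) ?normr_gt0// -expr2 -hdot_norm ST.
rewrite (le_trans (real_ler_norm _))//; first by rewrite -ST hdot_norm realX// normr_real.
by rewrite (le_trans (hdot_CS _ _))// mulrCA mulrA [leRHS]mulrC ler_wpM2l.
Qed.

(** Linearity is left out because an adjoint forces it ([adjoint_linear]). Demanding the adjoint as
    part of the predicate makes the involution available on an abstract [H] without the Riesz
    representation theorem. *)
Definition bh_pred : {pred H -> H} :=
  fun T => `[< (exists m, op_bound T m) /\ exists S, adjoint_of S T >].

Lemma bh_submod : submod_closed bh_pred.
Proof.
split=> [|c S T /asboolP[[m [m0 Sm]] [S' SS]] /asboolP[[n [n0 Tn]] [T' TT]]]; apply/asboolP.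
  split; [exists 0; split=> // h|exists (fun=> 0) => h k].
    by rewrite normr0 mul0r.
  by rewrite hdot0l hdot0r.
split.
  exists (Normc.normc c * m + n); split=> [|h].
    by rewrite addr_ge0// mulr_ge0// normc_ge0.
  rewrite (le_trans (ler_normD _ _))// rmorphD mulrDl lerD//.
  by rewrite normrZ rmorphM /= -mulrA ler_wpM2l.
exists (fun h => c^* *: S' h + T' h) => h k.
by rewrite hdotDl hdotDr hdotZl hdotZr conjCK SS TT.
Qed.

HB.instance Definition _ := GRing.isSubmodClosed.Build _ _ bh_pred bh_submod.

Record BH := MkBH { bh_val :> H -> H; bh_valP : bh_val \in bh_pred }.

HB.instance Definition _ := [isSub for bh_val].
HB.instance Definition _ := [Choice of BH by <:].
HB.instance Definition _ := [SubChoice_isSubLmodule of BH by <:].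

Lemma bh_ext (S T : BH) : S =1 T -> S = T.
Proof. by move=> ST; apply/val_inj/funext. Qed.

Lemma bh_bounded (T : BH) : exists m, op_bound T m.
Proof. by have /asboolP[] := bh_valP T. Qed.

Lemma bh_adjoint (T : BH) : exists S, adjoint_of S T.
Proof. by have /asboolP[] := bh_valP T. Qed.

Definition bh_mk (T : H -> H) (bT : exists m, op_bound T m)
  (aT : exists S, adjoint_of S T) : BH := MkBH (asboolT (conj bT aT)).

Definition bh_adj (T : BH) : H -> H := sval (cid (bh_adjoint T)).

Lemma bh_adjP T : adjoint_of (bh_adj T) T.
Proof. exact: svalP (cid (bh_adjoint T)). Qed.

Lemma bh_star_bounded T : exists m, op_bound (bh_adj T) m.
Proof.
by have [m Tm] := bh_bounded T; exists m; exact: adjoint_bound (bh_adjP T) Tm.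
Qed.

Definition bh_star (T : BH) : BH :=
  bh_mk (bh_star_bounded T) (ex_intro _ (bh_val T) (adjoint_ofC (bh_adjP T))).

Lemma bh_starP (T : BH) : adjoint_of (bh_star T) T.
Proof. exact: bh_adjP. Qed.

Lemma bh_mul_bounded (S T : BH) : exists m, op_bound (S \o T) m.
Proof.
have [m [m0 Sm]] := bh_bounded S; have [n [n0 Tn]] := bh_bounded T.
exists (m * n); split=> [|h]; first exact: mulr_ge0.
by rewrite (le_trans (Sm _))// rmorphM -mulrA ler_wpM2l// ler0c.
Qed.

Lemma bh_mul_adjoint (S T : BH) : adjoint_of (bh_star T \o bh_star S) (S \o T).
Proof. by move=> h k; rewrite /= !bh_starP. Qed.

Definition bh_mul (S T : BH) : BH :=
  bh_mk (bh_mul_bounded S T) (ex_intro (adjoint_of^~ (S \o T)) _ (bh_mul_adjoint S T)).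

Lemma bh_star_eq (S T : BH) : adjoint_of S T -> bh_star T = S.
Proof. by move=> ST; apply: bh_ext; exact: adjoint_unique (bh_starP T) ST. Qed.

Lemma bh_linear (T : BH) : linear T.
Proof. exact: adjoint_linear (bh_starP T). Qed.

Lemma bh_mulA : associative bh_mul.
Proof. by move=> a b c; exact: bh_ext. Qed.
Lemma bh_mulDl : left_distributive bh_mul +%R.
Proof. by move=> a b c; exact: bh_ext. Qed.
Lemma bh_mulDr : right_distributive bh_mul +%R.
Proof.
move=> a b c; apply: bh_ext => h.
by have := bh_linear a 1 (b h) (c h); rewrite !scale1r.
Qed.
Lemma bh_mulZl (c : R[i]) (a b : BH) : bh_mul (c *: a) b = c *: bh_mul a b.
Proof. exact: bh_ext. Qed.
Lemma bh_val0 (T : BH) : T 0 = 0.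
Proof. by have := bh_linear T (-1) 0 0; rewrite scaler0 addr0 scaleN1r addNr. Qed.
Lemma bh_mulZr (c : R[i]) (a b : BH) : bh_mul a (c *: b) = c *: bh_mul a b.
Proof.
apply: bh_ext => h.
by have := bh_linear a c (b h) 0; rewrite !addr0 bh_val0 addr0.
Qed.
Lemma bh_starK : involutive bh_star.
Proof. by move=> a; apply: bh_star_eq; apply: adjoint_ofC; exact: bh_starP. Qed.
Lemma bh_starD : {morph bh_star : a b / a + b}.
Proof.
move=> a b; apply: bh_star_eq => h k.
by rewrite [LHS]hdotDl [RHS]hdotDr !bh_starP.
Qed.
Lemma bh_starZ (c : R[i]) (a : BH) : bh_star (c *: a) = c^* *: bh_star a.
Proof.
by apply: bh_star_eq => h k; rewrite [LHS]hdotZl [RHS]hdotZr conjCK bh_starP.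
Qed.
Lemma bh_starM (a b : BH) : bh_star (bh_mul a b) = bh_mul (bh_star b) (bh_star a).
Proof. exact/bh_star_eq/bh_mul_adjoint. Qed.

HB.instance Definition _ := isStarAlgebra.Build R BH bh_mulA bh_mulDl bh_mulDr
  bh_mulZl bh_mulZr bh_starK bh_starD bh_starZ bh_starM.

Definition op_norm (T : H -> H) : R := inf [set m | op_bound T m].

Lemma op_norm_le T m : op_bound T m -> op_norm T <= m.
Proof. by move=> Tm; apply: ge_inf => //; exists 0 => n []. Qed.

Lemma op_norm_ge0 (T : H -> H) : (exists m, op_bound T m) -> 0 <= op_norm T.
Proof. by move=> [m Tm]; apply: lb_le_inf; [exists m|move=> n []]. Qed.

(** For nonzero [h] the ratio of [|T h|] to [|h|] is a lower bound of the set of all bounds, so the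
    infimum is itself a bound. *)
Lemma op_normP (T : H -> H) : (exists m, op_bound T m) -> op_bound T (op_norm T).
Proof.
move=> bT; split=> [|h]; first exact: op_norm_ge0.
have [->|h0] := eqVneq h 0.
  by have [m [_ /(_ 0)]] := bT; rewrite normr0 !mulr0.
have : 0 < `|h| by rewrite normr_gt0.
rewrite (normrR h) (normrR (T h)) -rmorphM lecR ltcR => h1.
rewrite -ler_pdivrMr//; apply: lb_le_inf; first by have [m] := bT; exists m.
move=> m [_ /(_ h)]; rewrite (normrR h) (normrR (T h)) -rmorphM lecR.
by rewrite ler_pdivrMr.
Qed.

Definition bh_norm (T : BH) : R[i] := (op_norm T)%:C%C.

Lemma le_bh_norm (T : BH) h : `|T h| <= bh_norm T * `|h|.
Proof. by have [_] := op_normP (bh_bounded T). Qed.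

Lemma bh_norm_ge0 T : 0 <= bh_norm T.
Proof. by rewrite ler0c; apply: op_norm_ge0; exact: bh_bounded. Qed.

Lemma bh_norm_le (T : BH) (m : R[i]) :
  0 <= m -> (forall h, `|T h| <= m * `|h|) -> bh_norm T <= m.
Proof.
move=> m0 Tm; have mE : m = (complex.Re m)%:C%C by rewrite RRe_real// ger0_real.
rewrite mE lecR; apply: op_norm_le; split; first by rewrite -ler0c -mE.
by rewrite -mE.
Qed.

Lemma bh_normD (S T : BH) : bh_norm (S + T) <= bh_norm S + bh_norm T.
Proof.
apply: bh_norm_le => [|h]; first by rewrite addr_ge0// bh_norm_ge0.
by rewrite (le_trans (ler_normD _ _))// mulrDl lerD// le_bh_norm.
Qed.

Lemma bh_norm_eq0 (T : BH) : bh_norm T = 0 -> T = 0.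
Proof.
move=> T0; apply: bh_ext => h; apply/eqP; rewrite -normr_le0.
by rewrite (le_trans (le_bh_norm T h))// T0 mul0r.
Qed.

Lemma bh_normZ (c : R[i]) (T : BH) : bh_norm (c *: T) = `|c| * bh_norm T.
Proof.
have le (a : R[i]) (S : BH) : bh_norm (a *: S) <= `|a| * bh_norm S.
  apply: bh_norm_le => [|h]; first by rewrite mulr_ge0// bh_norm_ge0.
  by rewrite [leLHS]normrZ -mulrA ler_wpM2l// le_bh_norm.
apply/eqP; rewrite eq_le le /=; have [->|c0] := eqVneq c 0.
  by rewrite normr0 mul0r bh_norm_ge0.
rewrite -ler_pdivlMl ?normr_gt0// -normfV.
by apply: le_trans (le _ _); rewrite scalerK.
Qed.

HB.instance Definition _ := Lmodule_isNormed.Build R[i] BH bh_normD bh_normZ bh_norm_eq0.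

Lemma bh_normE (T : BH) : `|T| = bh_norm T. Proof. by []. Qed.

Lemma bh_norm_star_le (T : BH) : `|bh_star T| <= `|T|.
Proof.
rewrite !bh_normE; apply: bh_norm_le => [|h]; first exact: bh_norm_ge0.
by have [] := adjoint_bound (bh_starP T) (op_normP (bh_bounded T)).
Qed.

Lemma bh_norm_star (T : BH) : `|bh_star T| = `|T|.
Proof.
by apply/le_anti; rewrite bh_norm_star_le -{1}(bh_starK T) bh_norm_star_le.
Qed.

Lemma bh_norm_mul (S T : BH) : `|amul S T| <= `|S| * `|T|.
Proof.
rewrite !bh_normE; apply: bh_norm_le => [|h]; first by rewrite mulr_ge0// bh_norm_ge0.
by rewrite (le_trans (le_bh_norm S (T h)))// -mulrA ler_wpM2l ?bh_norm_ge0 ?le_bh_norm.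
Qed.

Lemma bh_norm_star_mul (T : BH) : `|amul (star T) T| = `|T| ^+ 2.
Proof.
apply/le_anti/andP; split.
  by rewrite (le_trans (bh_norm_mul _ _))// expr2 bh_norm_star.
have m0 : 0 <= `|amul (star T) T| by []. set m := `|amul (star T) T| in m0 *.
(* The square root of [m] bounds [T], because the square of [|T h|] is the inner product of
   [star T (T h)] with [h]. *)
rewrite -[m]sqrtCK ler_pXn2r ?nnegrE ?sqrtC_ge0//.
rewrite bh_normE; apply: bh_norm_le => [|h]; first by rewrite sqrtC_ge0.
rewrite -(@ler_pXn2r _ 2) ?nnegrE ?mulr_ge0 ?sqrtC_ge0// exprMn sqrtCK.
rewrite -hdot_norm -bh_starP (le_trans (real_ler_norm _))//.
  by rewrite bh_starP hdot_norm realX// normr_real.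
rewrite (le_trans (hdot_CS _ _))// expr2 mulrA ler_wpM2r//.
exact: (le_bh_norm (amul (star T) T) h).
Qed.

(* Pointwise limits of the operators and of their adjoints, the latter serving
   as the adjoint of the limit. *)
Lemma bh_complete (F : set_system BH) : ProperFilter F -> cauchy F -> cvg F.
Proof.
move=> FF /(cauchyP _) Fc.
have ev (phi : BH -> H) (M : R[i]) : 0 <= M -> {morph phi : u v / u - v} ->
    (forall S, `|phi S| <= M * `|S|) -> cvg (phi @ F).
  move=> M0 phiB phiM; apply: cauchy_cvg; apply: cauchy_exP => e e0.
  have M1 : 0 < M + 1 by rewrite ltr_wpDl.
  have [S FS] := Fc _ (divr_gt0 e0 M1).
  exists (phi S); apply: (@filterS _ F _ (ball S (e / (M + 1)))) => // T.
  rewrite -!ball_normE /ball_ /= -phiB ltr_pdivlMr// => le.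
  rewrite (le_lt_trans (phiM _))// (le_lt_trans _ le)// mulrC ler_wpM2l//.
  by rewrite lerDl.
have evv h : cvg ((fun S : BH => S h) @ F).
  apply: (ev _ `|h|) => // S; rewrite mulrC; exact: le_bh_norm.
have starB (S T : BH) h : bh_star (S - T) h = bh_star S h - bh_star T h.
  change (star (S - T) h = star S h - star T h).
  by rewrite -scaleN1r starD starZ rmorphN1 scaleN1r.
have eva h : cvg ((fun S : BH => bh_star S h) @ F).
  apply: (ev _ `|h|) => // S; rewrite mulrC -bh_norm_star; exact: le_bh_norm.
pose L h := lim ((fun S : BH => S h) @ F).
pose L' h := lim ((fun S : BH => bh_star S h) @ F).
(* Compares [S] with a [T] that is close to [S] in norm and close to the limit at the one vector
   [h]. Since [T] may depend on [h], the pointwise limit inherits a bound that is uniform in [h]. *)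
have near_lim (phi : BH -> H -> H) (l : H -> H) (S : BH) (e : R[i]) :
    (forall h, (fun S => phi S h) @ F --> l h) ->
    (forall T h, `|phi S h - phi T h| <= `|S - T| * `|h|) ->
    F (ball S e) -> 0 < e -> forall h, `|phi S h - l h| <= e * `|h|.
  move=> phil phiB FS e0 h; apply/ler_addgt0Pr => d d0.
  have /cvg_ballP/(_ d d0) Fh := phil h.
  have [T [ST Td]] := filter_ex (filterI FS Fh).
  move: ST Td; rewrite /= -!ball_normE /ball_ /= => ST Td.
  rewrite -[phi S h](subrK (phi T h)) -addrA (le_trans (ler_normD _ _))// lerD//.
    by rewrite (le_trans (phiB _ _))// ler_wpM2r// ltW.
  by rewrite distrC ltW.
have approx (e : R[i]) : 0 < e -> exists S : BH, [/\ F (ball S e),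
    forall h, `|S h - L h| <= e * `|h| & forall h, `|bh_star S h - L' h| <= e * `|h|].
  move=> e0; have [S FS] := Fc e e0; exists S; split=> // h.
    apply: (near_lim (fun S => S) L) => // T k.
    exact: (le_bh_norm (S - T)).
  apply: (near_lim (fun S => bh_star S) L') => // T k.
  by rewrite -starB -(bh_norm_star (S - T)); exact: le_bh_norm.
have LP : adjoint_of L' L.
  move=> h k; apply/eqP; rewrite -subr_eq0 -normr_le0; apply/ler_addgt0Pr => e e0.
  have M1 : 0 < (`|h| * `|k|) + (`|h| * `|k|) + 1 by rewrite ltr_wpDl// addr_ge0// mulr_ge0.
  have d0 := divr_gt0 e0 M1; set d := e / _ in d0.
  have [S [_ SL SL']] := approx d d0.
  rewrite add0r (_ : _ - _ = hdot h (S k - L k) - hdot (bh_star S h - L' h) k); last first.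
    by rewrite hdotBl hdotBr bh_starP; ring.
  rewrite (le_trans (ler_normB _ _))//.
  apply: (@le_trans _ _ (d * (`|h| * `|k| + `|h| * `|k|))).
    rewrite mulrDr lerD//.
      by rewrite (le_trans (hdot_CS _ _))// [leRHS]mulrCA ler_wpM2l.
    by rewrite (le_trans (hdot_CS _ _))// mulrA ler_wpM2r.
  by rewrite /d -mulrA ger_pMr// mulrC ler_pdivrMr// mul1r lerDl.
have [S1 [_ S1L _]] := approx 1 ltr01.
have Lb : exists m, op_bound L m.
  exists (Normc.normc (1 + bh_norm S1)); apply: op_boundP => h.
  rewrite -[L h](subrK (S1 h)) (le_trans (ler_normD _ _))// mulrDl lerD ?le_bh_norm//.
  by rewrite distrC.
apply/cvg_ex; exists (bh_mk Lb (ex_intro _ L' LP)).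
apply/cvg_ballP => e e0; have e20 : 0 < e / 2 by rewrite divr_gt0.
have [S [FS SL _]] := approx _ e20.
apply: (@filterS _ F _ (ball S (e / 2))) => // T.
rewrite -!ball_normE /ball_ /= => ST; rewrite [e]splitr.
rewrite -[X in X - T](subrK S) -addrA (le_lt_trans (ler_normD _ _))//.
rewrite ler_ltD// bh_normE; apply: bh_norm_le => [|h]; first exact: ltW.
by rewrite -normrN opprB; exact: SL.
Qed.

HB.instance Definition _ := Uniform_isComplete.Build BH bh_complete.

HB.instance Definition _ := isCStarAlgebra.Build R BH bh_norm_mul bh_norm_star_mul.

Lemma bh_combE (c : R[i]) (S T : BH) h : (c *: S + T) h = c *: S h + T h.
Proof. by []. Qed.

Lemma bh_amulE (S T : BH) h : amul S T h = S (T h).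
Proof. by []. Qed.

Lemma hdot_starl (T : BH) h k : hdot (star T h) k = hdot h (T k).
Proof. exact: bh_starP. Qed.

Lemma hdot_starr (T : BH) h k : hdot h (star T k) = hdot (T h) k.
Proof. by rewrite hdotC bh_starP -hdotC. Qed.

End BoundedOperators.

(** * Square summable families *)

(* For a graph with one vertex, C_0(E^0) is the field of scalars and the graph
   correspondence is the Hilbert space of square summable families of edges. *)
Definition bouquet (I : countType) : graph :=
  @Graph unit I (fun=> tt) (fun=> tt).

Definition l2 (R : realType) (I : countType) := graph_corr R (bouquet I).

HB.instance Definition _ R I := GRing.Lmodule.on (l2 R I).

Section SquareSummable.
Variables (R : realType) (I : countType).
Implicit Types (x y z : l2 R I).
Local Notation normc := Normc.normc.

Lemma l2_vector (f : I -> R[i]) (M : R) :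
  (forall B : {fset I}, \sum_(i <- B) normc (f i) ^+ 2 <= M) ->
  @is_graph_vector R (bouquet I) f.
Proof.
move=> fM; split=> [[]|eps _].
  apply: (@le_lt_trans _ _ M%:E); last exact: ltry.
  apply: xhat_le_sums => B; rewrite (eq_bigl predT)// => e.
  by apply/mem_set.
by apply: sub_finite_set (finite_set1 tt) => -[].
Qed.

Definition l2_dot x y : R[i] := @gc_inner R (bouquet I) x y tt.

Lemma l2_dotDr x y z : l2_dot x (y + z) = l2_dot x y + l2_dot x z.
Proof. exact: gc_innerDr. Qed.

Lemma l2_dotZr c x y : l2_dot x (c *: y) = c * l2_dot x y.
Proof. exact: gc_innerZr. Qed.

Lemma l2_dotC x y : l2_dot x y = (l2_dot y x)^*.
Proof. exact: gc_innerC. Qed.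

Lemma l2_dot_diag x : l2_dot x x = (fine (@xhat R (bouquet I) x tt))%:C%C.
Proof. exact: gc_inner_diag. Qed.

Lemma l2_dot_ge0 x : 0 <= l2_dot x x.
Proof. by rewrite l2_dot_diag ler0c norm2_ge0. Qed.

Lemma l2_sum_le x (B : {fset I}) :
  \sum_(i <- B) normc (x i) ^+ 2 <= fine (@xhat R (bouquet I) x tt).
Proof.
have := @sum_le_norm2 R (bouquet I) x tt B.
by rewrite (eq_bigl predT)// => e; apply/mem_set.
Qed.

Lemma l2_dot_eq0 x : l2_dot x x = 0 -> x = 0.
Proof.
rewrite l2_dot_diag => /complexI x0; apply: (@gc_ext R (bouquet I)) => i.
have := l2_sum_le x [fset i]; rewrite x0 big_seq_fset1 => le0.
by apply: Normc.eq0_normc; apply/eqP; rewrite -sqrf_eq0 eq_le le0 sqr_ge0.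
Qed.

HB.instance Definition _ := Lmodule_isNormed.Build R[i] (l2 R I)
  (form_normD l2_dotDr l2_dotZr l2_dotC l2_dot_ge0 l2_dot_eq0)
  (form_normZ l2_dotZr l2_dotC l2_dot_ge0) (form_norm_eq0 l2_dot_eq0).

Lemma l2_dot_norm x : l2_dot x x = `|x| ^+ 2.
Proof. exact: form_norm_sqr. Qed.

Lemma l2_norm_le x (M : R) : 0 <= M ->
  (forall B : {fset I}, \sum_(i <- B) normc (x i) ^+ 2 <= M ^+ 2) ->
  `|x| <= M%:C%C.
Proof.
move=> M0 xM; rewrite -(@ler_pXn2r _ 2) ?nnegrE ?ler0c// -l2_dot_norm l2_dot_diag.
rewrite -rmorphXn lecR; apply: norm2_le => B.
by rewrite (eq_bigl predT)// => e; apply/mem_set.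
Qed.

Lemma l2_sum_norm x (B : {fset I}) : (\sum_(i <- B) normc (x i) ^+ 2)%:C%C <= `|x| ^+ 2.
Proof. by rewrite -l2_dot_norm l2_dot_diag lecR l2_sum_le. Qed.

Lemma l2_coord_le x i : `|(x : I -> R[i]) i| <= `|x|.
Proof.
rewrite -(@ler_pXn2r _ 2) ?nnegrE//; apply: le_trans (l2_sum_norm x [fset i]).
by rewrite big_seq_fset1 normr_normc rmorphXn.
Qed.

Definition l2_delta (i : I) : l2 R I := @gc_delta R (bouquet I) i.

Lemma l2_dot_delta i x : l2_dot (l2_delta i) x = x i.
Proof.
apply: usumE; rewrite -[X in has_sum _ _ X](_ : (((i == i)%:R : R[i])^* * x i) = _).
  apply: (@has_sum_single _ _ _ _ (fun j : I => (((j == i)%:R : R[i])^* * x j)) i) => //.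
  by move=> j _ /negbTE ->; rewrite rmorph0 mul0r.
by rewrite eqxx rmorph1 mul1r.
Qed.

Lemma l2_delta_norm i : `|l2_delta i| = 1.
Proof.
apply/eqP; rewrite -(@eqrXn2 _ 2)// expr1n -l2_dot_norm l2_dot_delta.
by rewrite /= eqxx.
Qed.

Definition l2_fin (f : I -> R[i]) (B : {fset I}) : l2 R I :=
  @gc_trunc R (bouquet I) f B.

Lemma l2_finE f B i : l2_fin f B i = if i \in B then f i else 0.
Proof. exact: gc_truncE. Qed.

Lemma l2_fin_norm_sum f (B : {fset I}) : `|l2_fin f B| <= \sum_(i <- B) `|f i|.
Proof.
rewrite (le_trans (ler_norm_sum _ _ _))//; apply: ler_sum => i _.
by rewrite [leLHS]normrZ l2_delta_norm mulr1.
Qed.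

Lemma l2_fin_norm_le f (B : {fset I}) (M : R[i]) : 0 <= M ->
  (\sum_(i <- B) normc (f i) ^+ 2)%:C%C <= M ^+ 2 -> `|l2_fin f B| <= M.
Proof.
move=> M0; have mE : M = (complex.Re M)%:C%C by rewrite RRe_real// ger0_real.
rewrite mE -rmorphXn lecR => fM; apply: l2_norm_le => [|C].
  by rewrite -ler0c -mE.
apply: le_trans fM; rewrite (big_fsetID _ (mem B))/=.
rewrite [X in _ + X]big1_fset => [|i]; last first.
  by rewrite !inE /= l2_finE => /andP[_ /negbTE ->] _; rewrite Normc.normc0 expr0n.
rewrite addr0 (@eq_fbigr _ _ _ _ _ _ _ (fun i => normc (f i) ^+ 2)); last first.
  by move=> i; rewrite !inE /= l2_finE => /andP[_ ->].
rewrite [leRHS](big_fsetID _ (mem C))/=.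
rewrite (_ : [fset x in C | x \in B] = [fset x in B | x \in C]).
  by rewrite lerDl sumr_ge0// => i _; exact: sqr_ge0.
by apply/fsetP => i; rewrite !inE /= andbC.
Qed.

Lemma l2_sum_fin f (B : {fset I}) :
  (\sum_(i <- B) normc (f i) ^+ 2)%:C%C <= `|l2_fin f B| ^+ 2.
Proof.
rewrite (le_trans _ (l2_sum_norm _ B))// lecR.
rewrite (@eq_fbigr _ _ _ _ _ _ _ (fun i => normc (l2_fin f B i) ^+ 2))// => i iB _.
by rewrite l2_finE iB.
Qed.

(** The candidate [X] is the coordinatewise limit. A bound on [X - x] over finite sets [B] that does
    not depend on [B] shows at once that [X] is square summable and that the convergence holds in
    norm. *)
Lemma l2_complete (F : set_system (l2 R I)) : ProperFilter F -> cauchy F -> cvg F.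
Proof.
move=> FF /(cauchyP _) Fc.
have ev i : cvg ((fun x : l2 R I => x i : R[i]^o) @ F).
  apply: complex_complete; apply: cauchy_exP => e e0; have [x Fx] := Fc e e0.
  exists (x i); apply: (@filterS _ F _ (ball x e)) => //= y.
  rewrite -!ball_normE /ball_ /=; apply: le_lt_trans.
  exact: (l2_coord_le (x - y)).
pose X i : R[i] := lim ((fun x : l2 R I => x i : R[i]^o) @ F).
have near_sum (s : seq I) (e : R[i]) : 0 < e ->
    F [set y : l2 R I | \sum_(i <- s) `|X i - y i| < e].
  elim: s e => [|i s IHs] e e0.
    by apply: filterS filterT => y _; rewrite /= big_nil.
  have e20 : 0 < e / 2 by rewrite divr_gt0.
  have /cvg_ballP/(_ _ e20) := ev i; rewrite /= => Fi.
  apply: filterS (filterI Fi (IHs _ e20)) => y [].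
  rewrite /= -ball_normE /ball_ /= => yi ys; rewrite big_cons [e]splitr.
  exact: ltrD.
have approx (e : R[i]) (x : l2 R I) (B : {fset I}) : 0 < e -> F (ball x e) ->
    (\sum_(i <- B) normc (X i - x i) ^+ 2)%:C%C <= e ^+ 2.
  move=> e0 Fx; rewrite (le_trans (l2_sum_fin _ _))// ler_pXn2r ?nnegrE//; last exact: ltW.
  apply/ler_addgt0Pr => d d0.
  have [y [Fy]] := filter_ex (filterI Fx (near_sum B d d0)).
  move: Fy; rewrite /= -ball_normE /ball_ /= distrC => xy yX.
  have -> : l2_fin (fun i => X i - x i) B =
      l2_fin (y - x : l2 R I) B + l2_fin (fun i => X i - y i) B.
    rewrite /l2_fin /gc_trunc -big_split; apply: eq_bigr => i _ /=.
    rewrite -scalerDl; congr (_ *: _); rewrite [RHS]addrC.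
    by change (X i - x i = X i - y i + (y i - x i)); rewrite addrA subrK.
  apply: (le_trans (ler_normD _ _)); apply: lerD; last first.
    exact: le_trans (l2_fin_norm_sum _ _) (ltW yX).
  apply: l2_fin_norm_le; first exact: ltW.
  apply: le_trans (l2_sum_norm _ _) _.
  rewrite ler_pXn2r ?nnegrE; [exact: ltW|by []|exact: normr_ge0|exact: ltW].
have [x1 Fx1] := Fc 1 ltr01.
have X1 : @is_graph_vector R (bouquet I) (fun i => X i - x1 i).
  apply: (@l2_vector _ 1) => B; rewrite -lecR.
  by rewrite (le_trans (approx _ _ B _ Fx1))// expr1n.
have XV : X \in @graph_vector_pred R (bouquet I).
  rewrite (_ : X = (fun i => X i - x1 i : R[i]^o) + (x1 : I -> R[i]^o)); last first.
    by apply/funext => i; rewrite /= [RHS]subrK.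
  by apply: rpredD; [exact/asboolP|exact: gc_valP].
apply/cvg_ex; exists (MkGraphCorr XV : l2 R I); apply/cvg_ballP => -[e e'] e0.
have ee' : e' = 0 by move: e0; rewrite ltcE /= => /andP[/eqP].
rewrite {}ee' in e0 *; have {}e0 : 0 < e by move: e0; rewrite ltcR.
have e20 : 0 < e / 2 by rewrite divr_gt0.
have e20C : 0 < (e / 2)%:C%C :> R[i] by rewrite ltcR.
have [x Fx] := Fc _ e20C.
apply: (@filterS _ F _ (ball x (e / 2)%:C%C)) => // y; rewrite -!ball_normE /ball_ /= => xy.
have -> : (e +i* 0)%C = (e / 2)%:C%C + (e / 2)%:C%C by rewrite -rmorphD -splitr.
rewrite -[X in X - y](subrK x) -addrA; apply: le_lt_trans (ler_normD _ _) _.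
apply: ler_ltD xy; apply: l2_norm_le => [|B]; first exact: ltW.
rewrite -lecR [leRHS]rmorphXn; exact: (approx _ x B e20C Fx).
Qed.

HB.instance Definition _ := Uniform_isComplete.Build (l2 R I) l2_complete.

HB.instance Definition _ := isHilbert.Build R (l2 R I)
  l2_dotDr l2_dotZr l2_dotC l2_dot_norm.

End SquareSummable.

(** * Operators on square summable families *)

Section l2Operators.
Variables (R : realType) (I : countType).
Local Notation K := (l2 R I).
Implicit Types (x y : K).
Local Notation normc := Normc.normc.
Local Notation norm2 x := (fine (@xhat R (bouquet I) x tt)).

Lemma l2_norm2 x : `|x| ^+ 2 = (norm2 x)%:C%C.
Proof. by rewrite -l2_dot_norm l2_dot_diag. Qed.

Lemma hdot_l2_delta i x : hdot (l2_delta R i : K) x = x i.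
Proof. exact: l2_dot_delta. Qed.

Lemma l2_fin_norm f (B : {fset I}) :
  `|l2_fin f B : K| ^+ 2 = (\sum_(i <- B) normc (f i) ^+ 2)%:C%C.
Proof.
apply/le_anti; rewrite l2_sum_fin andbT.
set s := _%:C%C; have s0 : 0 <= s by rewrite ler0c sumr_ge0// => i _; exact: sqr_ge0.
rewrite -[leRHS]sqrtCK; apply: lerXn2r.
- by rewrite nnegrE.
- by rewrite nnegrE sqrtC_ge0.
by apply: l2_fin_norm_le; rewrite ?sqrtC_ge0// sqrtCK.
Qed.

Lemma l2_dense x (e : R[i]) : 0 < e -> exists B : {fset I}, `|x - l2_fin x B| <= e.
Proof.
move: e => [e e']; rewrite ltcE /= => /andP[/eqP -> e0].
have [B hB] := @gc_approx R (bouquet I) x (e ^+ 2) (exprn_gt0 2 e0).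
exists B; change (`|x - l2_fin x B| <= e%:C%C :> R[i]).
have e0C : 0 <= e%:C%C :> R[i] by rewrite ler0c ltW.
rewrite -(@ler_pXn2r _ 2) ?nnegrE//.
by rewrite -rmorphXn l2_norm2 lecR; exact: hB.
Qed.

(** The coordinates of [S y] have to be the inner products [c y i] of [T (l2_delta R i)] with [y].
    Testing [T] on a truncation of [c y] and dividing by its norm shows that they are square
    summable; the adjoint relation holds for finitely supported [x] and extends by density. *)
Lemma l2_adjoint (T : K -> K) (m : R) : linear T -> op_bound T m ->
  exists S, adjoint_of S T.
Proof.
move=> Tl [m0 Tm].
have T0 : T 0 = 0 by have := Tl (-1) 0 0; rewrite scaler0 addr0 scaleN1r addNr.
have TZ c x : T (c *: x) = c *: T x.
  by have := Tl c x 0; rewrite T0 !addr0.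
have TD x y : T (x + y) = T x + T y by have := Tl 1 x y; rewrite !scale1r.
have Tsum (f : I -> R[i]) (B : {fset I}) :
    T (l2_fin f B) = \sum_(i <- B) f i *: T (l2_delta R i).
  by rewrite (big_morph T TD T0); apply: eq_bigr => i _; rewrite TZ.
pose c y i := hdot (T (l2_delta R i)) y.
have cB y (B : {fset I}) : (\sum_(i <- B) normc (c y i) ^+ 2)%:C%C <= (m%:C%C * `|y|) ^+ 2.
  rewrite -l2_fin_norm ler_pXn2r ?nnegrE ?mulr_ge0 ?ler0c//.
  have [->|f0] := eqVneq (l2_fin (c y) B) 0; first by rewrite normr0 mulr_ge0 ?ler0c.
  rewrite -(@ler_pM2l _ `|l2_fin (c y) B|) ?normr_gt0// -expr2 l2_fin_norm.
  rewrite (_ : (\sum_(i <- B) _)%:C%C = hdot (T (l2_fin (c y) B)) y).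
    rewrite (le_trans (real_ler_norm _))//.
      rewrite Tsum hdot_suml rpred_sum// => i _.
      by rewrite hdotZl mulrC -normCK realX// normr_real.
    apply: (@le_trans _ _ (`|T (l2_fin (c y) B)| * `|y|)).
      exact: hdot_CS.
    rewrite [leRHS]mulrA; apply: ler_wpM2r; first exact: normr_ge0.
    by rewrite [leRHS]mulrC; exact: Tm.
  rewrite Tsum hdot_suml rmorph_sum; apply: eq_bigr => i _ /=.
  by rewrite hdotZl mulrC -normCK normr_normc -rmorphXn.
have cV y : @is_graph_vector R (bouquet I) (c y).
  apply: (@l2_vector _ _ _ ((m * complex.Re `|y|) ^+ 2)) => B.
  by rewrite -lecR rmorphXn rmorphM /= -normrR.
pose S y : K := MkGraphCorr (asboolT (cV y)).
exists S => y x; apply/eqP; rewrite -subr_eq0 -normr_le0; apply/ler_addgt0Pr => e e0.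
have M1 : 0 < `|S y| + `|y| * m%:C%C + 1 by rewrite ltr_wpDl// addr_ge0// mulr_ge0// ler0c.
have [B hB] := l2_dense x (divr_gt0 e0 M1).
have fin_eq : hdot (S y) (l2_fin x B) = hdot y (T (l2_fin x B)).
  rewrite Tsum [LHS]hdot_sumr hdot_sumr; apply: eq_bigr => i _.
  rewrite [LHS]hdotZr [RHS]hdotZr.
  have E : hdot (S y) (l2_delta R i : K) = hdot y (T (l2_delta R i)).
    by rewrite [LHS]hdotC [RHS]hdotC hdot_l2_delta.
  exact: (congr1 ( *%R (x i : R[i])) E).
have TB : T x - T (l2_fin x B) = T (x - l2_fin x B).
  by rewrite TD -scaleN1r -[- l2_fin x B]scaleN1r TZ.
have -> : hdot (S y) x - hdot y (T x) =
    hdot (S y) (x - l2_fin x B) - hdot y (T (x - l2_fin x B)).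
  rewrite -TB [X in _ = X - _]hdotBr [X in _ = _ - X]hdotBr fin_eq.
  by rewrite [X in _ = _ + X]opprB [RHS]addrA [X in _ = X - _]subrK.
rewrite add0r; apply: le_trans (ler_normB _ _) _.
apply: (@le_trans _ _ ((`|S y| + `|y| * m%:C%C) * `|x - l2_fin x B|)).
  rewrite mulrDl; apply: lerD; first exact: hdot_CS.
  apply: (@le_trans _ _ (`|y| * `|T (x - l2_fin x B)|)); first exact: hdot_CS.
  rewrite -[leRHS]mulrA.
  by apply: ler_wpM2l; [exact: normr_ge0|exact: Tm].
apply: le_trans (_ : (`|S y| + `|y| * m%:C%C + 1) * `|x - l2_fin x B| <= _).
  by apply: ler_wpM2r; [exact: normr_ge0|rewrite lerDl].
by rewrite mulrC -ler_pdivlMr.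
Qed.

Lemma l2_op (f : K -> I -> R[i]) (M : R) : 0 <= M ->
  (forall x (B : {fset I}), \sum_(i <- B) normc (f x i) ^+ 2 <= M * norm2 x) ->
  (forall c x y i, f (c *: x + y) i = c * f x i + f y i) ->
  exists T : BH K, forall x i, T x i = f x i.
Proof.
move=> M0 fM fl.
have fV x : @is_graph_vector R (bouquet I) (f x) by apply: l2_vector (fM x).
pose T x : K := MkGraphCorr (asboolT (fV x)).
have Tl : linear T by move=> c x y; apply: (@gc_ext R (bouquet I)) => i; exact: fl.
have Tm : op_bound T (Num.sqrt M).
  split=> [|x]; first exact: sqrtr_ge0.
  have xE := normrR x; have x0 : 0 <= complex.Re `|x| by rewrite -ler0c -xE.
  rewrite xE -rmorphM; apply: l2_norm_le => [|B].
    by rewrite mulr_ge0 ?sqrtr_ge0.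
  rewrite exprMn sqr_sqrtr//; apply: le_trans (fM x B) _; rewrite ler_wpM2l//.
  by rewrite -lecR rmorphXn /= -xE l2_norm2.
by exists (bh_mk (ex_intro _ _ Tm) (l2_adjoint Tl Tm)).
Qed.

(** The coordinates of [star S y] are conjugate inner products of [y] with the images under [S] of
    the basis vectors. So the matrix determines the adjoints, hence the operators, without a density
    argument. *)
Lemma bh_l2_ext (S T : BH K) :
  (forall i j, hdot (l2_delta R i) (S (l2_delta R j)) =
    hdot (l2_delta R i) (T (l2_delta R j))) ->
  S = T.
Proof.
move=> ST; have {}ST j : S (l2_delta R j) = T (l2_delta R j).
  by apply: (@gc_ext R (bouquet I)) => i; have := ST i j; rewrite !hdot_l2_delta.
rewrite -[S]starK -[T]starK; congr star; apply: bh_ext => y.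
apply: (@gc_ext R (bouquet I)) => i.
have adj (U : BH K) : star U y i = (hdot y (U (l2_delta R i)))^*.
  by rewrite -(bh_starP U) -hdotC; apply/esym; exact: hdot_l2_delta.
apply: etrans (adj S) (etrans _ (esym (adj T))).
by rewrite ST.
Qed.

End l2Operators.

Lemma ler_sum_fset (R : numDomainType) (I : choiceType) (A B : {fset I}) (g : I -> R) :
  (forall i, 0 <= g i) -> (forall i, i \in A -> g i != 0 -> i \in B) ->
  \sum_(i <- A) g i <= \sum_(i <- B) g i.
Proof.
move=> g0 AB; have -> : \sum_(i <- A) g i = \sum_(i <- [fset i in A | g i != 0]) g i.
  apply/esym; apply: big_fset_incl => [|i iA].
    by apply/fsubsetP => i; rewrite !inE /= => /andP[].
  by rewrite !inE /= iA /= negbK => /eqP.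
rewrite [leRHS](big_fsetID _ (mem [fset i in A | g i != 0])) /=.
rewrite [X in _ <= X + _](_ : _ = \sum_(i <- [fset i in A | g i != 0]) g i).
  by rewrite lerDl sumr_ge0.
apply: eq_fbigl => i; rewrite !inE /=.
by have [/andP[iA gi]|_] := boolP ((i \in A) && (g i != 0)); rewrite ?andbF ?(AB _ iA gi).
Qed.

(** * A Toeplitz representation that kills no vertex *)

Section Fock.
Variables (R : realType) (E : graph).
(* The basis consists of all pairs of a vertex and a word in the edges, whether
   or not the word is a path: [S_e] sends the basis vector [(src e, w)] to
   [(rng e, e :: w)] and [P_v] projects onto the vectors with first entry [v]. *)
Definition fock_index : countType := (vertex E * seq (edge E))%type.
Local Notation K := (l2 R fock_index).
Local Notation normc := Normc.normc.
Local Notation norm2 x v := (fine (xhat x v)).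

(** In coordinates, the sum over all [e] of [x e] times [S_e]: the word at [i] reveals the one edge
    that contributes there, and empty words are not reached. *)
Definition fock_sigma_fun (x : graph_corr R E) (xi : K) (i : fock_index) : R[i] :=
  if i.2 is e :: w then (i.1 == rng e)%:R * (x e * xi (src e, w)) else 0.

Lemma fock_sigma_cons x xi u e w :
  fock_sigma_fun x xi (u, e :: w) = (u == rng e)%:R * (x e * xi (src e, w)).
Proof. by []. Qed.

Lemma fock_sigma_nil x xi u : fock_sigma_fun x xi (u, [::]) = 0.
Proof. by []. Qed.

Lemma gc_norm2_bounded (x : graph_corr R E) : exists2 M : R, 0 <= M & forall v, norm2 x v <= M.
Proof.
have [M M0 xM] := c0_bounded (gc_inner x x); exists M => // v.
have := xM v; rewrite -lecR -normr_normc gc_inner_diag xhat_fine_norm.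
by rewrite lecR.
Qed.

(** A nonzero coordinate sits at some [h (w, e)], which determines [w] and [e]. Grouping the pairs
    by the coordinate [k (w, e)] of [xi] that they read leaves, for each group, a sum of squares of
    [x] over edges with one common source, which is at most [M]. *)
Lemma fock_sigma_bound (x : graph_corr R E) (M : R) (xi : K) (B : {fset fock_index}) :
  0 <= M -> (forall v, norm2 x v <= M) ->
  \sum_(i <- B) normc (fock_sigma_fun x xi i) ^+ 2 <=
    M * fine (@xhat R (bouquet fock_index) xi tt).
Proof.
move=> M0 xM.
pose h (p : seq (edge E) * edge E) : fock_index := (rng p.2, p.2 :: p.1).
have hI : injective h by move=> [w e] [w' e'] [_ -> ->].
pose P := fset_set [set p | h p \in B].
have finP : finite_set [set p | h p \in B].
  by apply: (finite_preimage (f := h) _ (finite_fset B)) => ? ? _ _; exact: hI.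
apply: (@le_trans _ _ (\sum_(i <- [fset h p | p in P]) normc (fock_sigma_fun x xi i) ^+ 2)).
  apply: ler_sum_fset => [i|[u [|e w]] iB]; first exact: sqr_ge0.
    by rewrite fock_sigma_nil Normc.normc0 expr0n eqxx.
  rewrite fock_sigma_cons; have [ue _|_] := eqVneq u (rng e); last first.
    by rewrite mul0r Normc.normc0 expr0n eqxx.
  apply/imfsetP; exists (w, e); last by rewrite /h /= ue.
  by rewrite in_fset_set//; apply/mem_set; rewrite /= /h /= -ue.
rewrite big_imfset /=; last by move=> ? ? _ _; exact: hI.
pose k (p : seq (edge E) * edge E) : fock_index := (src p.2, p.1).
rewrite (partition_big_imfset _ k) /=.
apply: (@le_trans _ _ (\sum_(j <- [fset k p | p in P]) M * normc (xi j) ^+ 2)); last first.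
  by rewrite -mulr_sumr ler_wpM2l ?l2_sum_le.
apply: ler_sum => j _.
rewrite (eq_bigr (fun p => normc (x p.2) ^+ 2 * normc (xi j) ^+ 2)); last first.
  by move=> p /eqP <-; rewrite fock_sigma_cons eqxx mul1r Normc.normcM exprMn.
rewrite -mulr_suml ler_wpM2r ?sqr_ge0//; apply: le_trans (xM j.1).
rewrite big_fset_condE.
have -> : \sum_(i <- [fset i in P | k i == j]) normc (x i.2) ^+ 2 =
    \sum_(e <- [fset p.2 | p in [fset i in P | k i == j]]) normc (x e) ^+ 2.
  rewrite [RHS]big_imfset //= => -[w e] [w' e']; rewrite !inE /=.
  by move=> /andP[_ /eqP <-] /andP[_ /eqP [_ ->]] ->.
have := sum_le_norm2 x j.1 [fset p.2 | p in [fset i in P | k i == j]].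
rewrite big_fset_condE (_ : [fset i in _ | _] = [fset p.2 | p in [fset i in P | k i == j]])//.
apply/fsetP => e; rewrite !inE /= andb_idr// => /imfsetP[p] /=.
by rewrite !inE => /andP[_ /eqP <-] ->.
Qed.

Lemma fock_sigma_op x : exists T : BH K, forall xi i, T xi i = fock_sigma_fun x xi i.
Proof.
have [M M0 xM] := gc_norm2_bounded x.
apply: (l2_op M0) => [xi B|c xi eta [u [|e w]]]; first exact: fock_sigma_bound.
  by rewrite !fock_sigma_nil mulr0 addr0.
rewrite !fock_sigma_cons.
change ((c *: xi + eta) (src e, w)) with (c * xi (src e, w) + eta (src e, w)).
by ring.
Qed.

Lemma fock_pi_op (a : C0 R (vertex E)) : exists T : BH K, forall xi i, T xi i = a i.1 * xi i.
Proof.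
have [M M0 aM] := c0_bounded a.
apply: (l2_op (sqr_ge0 M)) => [xi B|c xi eta i]; last first.
  by rewrite -[(c *: xi + eta) i]/(c * xi i + eta i); ring.
apply: (@le_trans _ _ (\sum_(i <- B) M ^+ 2 * normc (xi i) ^+ 2)).
  apply: ler_sum => i _; rewrite Normc.normcM exprMn ler_wpM2r ?sqr_ge0//.
  by rewrite ler_sqr ?nnegrE ?normc_ge0.
by rewrite -mulr_sumr ler_wpM2l ?sqr_ge0 ?l2_sum_le.
Qed.

Definition fock_sigma x : BH K := sval (cid (fock_sigma_op x)).
Definition fock_pi a : BH K := sval (cid (fock_pi_op a)).

Lemma fock_sigmaE x xi i : fock_sigma x xi i = fock_sigma_fun x xi i.
Proof. exact: (svalP (cid (fock_sigma_op x))). Qed.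

Lemma fock_piE a xi i : fock_pi a xi i = a i.1 * xi i.
Proof. exact: (svalP (cid (fock_pi_op a))). Qed.

End Fock.

Section FockRepresentation.
Variables (R : realType) (E : graph).
Local Notation I := (fock_index E).
Local Notation K := (l2 R I).
Local Notation sg := (@fock_sigma R E).
Local Notation pi := (@fock_pi R E).

Lemma l2_ext (x y : K) : (forall i, x i = y i) -> x = y.
Proof. exact: gc_ext. Qed.

Lemma l2_combE (c : R[i]) (x y : K) i : (c *: x + y) i = c * x i + y i.
Proof. by []. Qed.

Lemma fock_sigma_linear : linear sg.
Proof.
move=> c x y; apply: bh_ext => xi; apply: l2_ext => -[u w].
rewrite bh_combE l2_combE (fock_sigmaE x) (fock_sigmaE y) fock_sigmaE.
case: w => [|e w]; first by rewrite !fock_sigma_nil mulr0 addr0.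
rewrite !fock_sigma_cons -[(c *: x + y) e]/(c * x e + y e).
by ring.
Qed.

Lemma fock_pi_star (a : C0 R (vertex E)) : adjoint_of (pi (c0_star a)) (pi a).
Proof.
move=> xi eta; rewrite /hdot /= /l2_dot /=; congr usum; apply/funext => i.
rewrite (fock_piE a) (fock_piE (c0_star a)) rmorphM /= conjCK; ring.
Qed.

Lemma fock_pi_hom : star_hom pi.
Proof.
split=> [c a b|a b|a].
- apply: bh_ext => xi; apply: l2_ext => i; 
  rewrite bh_combE l2_combE (fock_piE a) (fock_piE b) fock_piE.
  rewrite -[(c *: a + b) i.1]/(c * a i.1 + b i.1).
  by ring.
- apply: bh_ext => xi; apply: l2_ext => i; 
  apply: (etrans (fock_piE _ _ _)); apply/esym.
  apply: (etrans (fock_piE a (pi b xi) i)); rewrite (fock_piE b).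
  by rewrite -[amul a b i.1]/(a i.1 * b i.1) mulrA.
- by apply/esym; apply: bh_star_eq; exact: fock_pi_star.
Qed.

Lemma l2_deltaE (i j : I) : l2_delta R i j = (j == i)%:R.
Proof. by []. Qed.

Lemma fock_toeplitz : toeplitz_representation sg pi.
Proof.
split; [exact: fock_sigma_linear|exact: fock_pi_hom|move=> x a|move=> a x|move=> x y].
- apply: bh_ext => xi; apply: l2_ext => -[u w].
  apply: (etrans (fock_sigmaE _ _ _)); apply/esym.
  apply: (etrans (fock_sigmaE x (pi a xi) (u, w))).
  case: w => [//|e w]; rewrite !fock_sigma_cons (fock_piE a).
  rewrite -[gc_ract x a e]/(x e * a (src e)) /=; ring.
- apply: bh_ext => xi; apply: l2_ext => -[u w].
  apply: (etrans (fock_sigmaE _ _ _)); apply/esym.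
  apply: (etrans (fock_piE a (sg x xi) (u, w))); rewrite (fock_sigmaE x).
  case: w => [|e w]; first by rewrite !fock_sigma_nil mulr0.
  rewrite !fock_sigma_cons -[gc_lact a x e]/(a (rng e) * x e) /=.
  by have [->|_] := eqVneq u (rng e); [ring|rewrite !mul0r mulr0].
(* The matrix coefficient on the right is a sum over all of [I]. Its terms vanish unless [i = j] and
   the index is [(rng e, e :: i.2)] with [src e = i.1], so it reindexes to the sum over a fiber that
   defines [gc_inner]. *)
apply: bh_l2_ext => i j.
apply: (etrans (hdot_l2_delta _ _)); rewrite (fock_piE (gc_inner x y)) l2_deltaE.
transitivity (hdot (sg x (l2_delta R i)) (sg y (l2_delta R j))); last first.
  by rewrite bh_amulE hdot_starr.
apply/esym/usumE.
have term0 k : (forall e, k != (rng e, e :: i.2) \/ src e != i.1) \/ i != j ->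
   (sg x (l2_delta R i) k : R[i])^* * sg y (l2_delta R j) k = 0.
  case: k => u [|e w]; first by rewrite (fock_sigmaE x) (fock_sigmaE y) !fock_sigma_nil mulr0.
  rewrite (fock_sigmaE x) (fock_sigmaE y) !fock_sigma_cons !l2_deltaE => h.
  have [ij|] := eqVneq (src e, w) i; last by rewrite !mulr0 rmorph0 mul0r.
  have [jj|] := eqVneq (src e, w) j; last by rewrite !mulr0.
  have [ue|_] := eqVneq u (rng e); last by rewrite !mul0r mulr0.
  case: h => [/(_ e)|]; last by rewrite -ij -jj eqxx.
  by rewrite -ij ue !eqxx => -[].
have [ij|ij] := eqVneq i j; last first.
  rewrite mulr0; apply: has_sum0 => k _; apply: term0; by right.
rewrite mulr1.
apply/(@has_sum_reindex _ _ _ _ (fun e : edge E => (rng e, e :: i.2) : I) (fiber i.1)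
  _ (fun e => (x e : R[i])^* * (y e : R[i]))).
- by move=> e f [].
- by [].
- move=> e ei; rewrite (fock_sigmaE x) (fock_sigmaE y) !fock_sigma_cons eqxx.
  rewrite !l2_deltaE -ij (ei : src e = i.1).
  by rewrite -surjective_pairing eqxx !mul1r !mulr1.
- move=> k _ ki; apply: term0; left => e.
  have [kE|] := eqVneq k (rng e, e :: i.2); [right|by left].
  by apply/eqP => si; apply: ki; exists e.
exact: gc_inner_has_sum.
Qed.

Lemma ta_vertex_neq0 (T : toeplitz_algebra R E) v : ta_vertex T v != 0.
Proof.
have [rho [[[rhoL _ _] _ rhop] _]] := ta_univ T fock_toeplitz.
apply/eqP => v0.
have : pi (c0_delta R v) = 0.
  rewrite rhop /= -/(ta_vertex T v) v0.
  by have := rhoL (-1) 0 0; rewrite scaler0 addr0 scaleN1r addNr.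
(* The basis vector at [v] with the empty word is fixed by the image of the vertex [v]. *)
move=> /(congr1 (fun S : BH K => S (l2_delta R (v, [::])) (v, [::]))).
rewrite fock_piE l2_deltaE eqxx mulr1 /= eqxx => /eqP.
by rewrite oner_eq0.
Qed.

End FockRepresentation.

Lemma toeplitz_comp (R : realType) (E : graph) (T : toeplitz_algebra R E)
    (B : cstarAlgType R) (f : T -> B) : star_hom f ->
  toeplitz_representation (f \o ta_sigma T) (f \o ta_pi T).
Proof.
move=> fh; have [sl ph sr sleft sin] := ta_rep T; have [fl fM fs] := fh.
split=> [c x y||x a|a x|x y] /=.
- by rewrite sl fl.
- exact: star_hom_comp.
- by rewrite sr fM.
- by rewrite sleft fM.
- by rewrite sin fM fs.
Qed.

(** The uniqueness half of the universal property stands in for density of the algebra generated by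
    the images of X(E) and C_0. *)
Lemma toeplitz_hom_ext (R : realType) (E : graph) (T : toeplitz_algebra R E)
    (B : cstarAlgType R) (f g : T -> B) : star_hom f -> star_hom g ->
  (forall x, f (ta_sigma T x) = g (ta_sigma T x)) ->
  (forall a, f (ta_pi T a) = g (ta_pi T a)) -> f = g.
Proof.
move=> fh gh fgs fgp; have [rho [_ uniq]] := ta_univ T (toeplitz_comp fh).
rewrite -(uniq f) ?(uniq g)//; split=> //; apply/funext => x /=.
  exact: fgs.
exact: fgp.
Qed.

(** * Toeplitz representations on a Hilbert space *)

Section BHLinear.
Variables (R : realType) (H : hilbertType R) (T : BH H).

Lemma bhD x y : T (x + y) = T x + T y.
Proof. by have := bh_linear T 1 x y; rewrite !scale1r. Qed.

Lemma bhZ c x : T (c *: x) = c *: T x.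
Proof. by have := bh_linear T c x 0; rewrite bh_val0 !addr0. Qed.

Lemma bhB x y : T (x - y) = T x - T y.
Proof. by rewrite bhD -scaleN1r bhZ scaleN1r. Qed.

Lemma bh_sum (I : Type) (s : seq I) (P : pred I) (f : I -> H) :
  T (\sum_(i <- s | P i) f i) = \sum_(i <- s | P i) T (f i).
Proof. exact: (big_morph T bhD (bh_val0 T)). Qed.

End BHLinear.

Section ToeplitzOperators.
Variables (R : realType) (E : graph) (H : hilbertType R).
Variables (sg : graph_corr R E -> BH H) (pi : C0 R (vertex E) -> BH H).
Hypothesis rep : toeplitz_representation sg pi.
Local Notation P v := (pi (c0_delta R v)).
Local Notation S e := (sg (gc_delta R e)).
Local Notation normc := Normc.normc.
Local Notation norm2 x v := (fine (xhat x v)).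

Let sgL : linear sg. Proof. by have [] := rep. Qed.
Let piH : star_hom pi. Proof. by have [] := rep. Qed.
Let piL : linear pi. Proof. by have [] := piH. Qed.
Let sgr x a : sg (gc_ract x a) = amul (sg x) (pi a). Proof. by have [] := rep. Qed.
Let sgl a x : sg (gc_lact a x) = amul (pi a) (sg x). Proof. by have [] := rep. Qed.
Let piI x y : pi (gc_inner x y) = amul (star (sg x)) (sg y).
Proof. by have [] := rep. Qed.
Let piM a b : pi (amul a b) = amul (pi a) (pi b). Proof. by have [] := piH. Qed.
Let piS a : pi (star a) = star (pi a). Proof. by have [] := piH. Qed.

Lemma toep_pi_linear c a b h : pi (c *: a + b) h = c *: pi a h + pi b h.
Proof. by rewrite piL. Qed.

Lemma toep_sg_linear c x y h : sg (c *: x + y) h = c *: sg x h + sg y h.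
Proof. by rewrite sgL. Qed.

Lemma toep_pi0 : pi 0 = 0.
Proof. by have := piL (-1) 0 0; rewrite scaler0 addr0 scaleN1r addNr. Qed.

Lemma toep_sg0 : sg 0 = 0.
Proof. by have := sgL (-1) 0 0; rewrite scaler0 addr0 scaleN1r addNr. Qed.

Lemma toep_piZ c a h : pi (c *: a) h = c *: pi a h.
Proof. by have := toep_pi_linear c a 0 h; rewrite toep_pi0 !addr0. Qed.

Lemma toep_sgZ c x h : sg (c *: x) h = c *: sg x h.
Proof. by have := toep_sg_linear c x 0 h; rewrite toep_sg0 !addr0. Qed.

Lemma toep_piB a b h : pi (a - b) h = pi a h - pi b h.
Proof. by rewrite addrC -scaleN1r toep_pi_linear scaleN1r addrC. Qed.

Lemma toep_sgB x y h : sg (x - y) h = sg x h - sg y h.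
Proof. by rewrite addrC -scaleN1r toep_sg_linear scaleN1r addrC. Qed.

Lemma toep_pi_sum (I : Type) (s : seq I) (f : I -> C0 R (vertex E)) h :
  pi (\sum_(i <- s) f i) h = \sum_(i <- s) pi (f i) h.
Proof.
apply: (big_morph (fun a => pi a h)) => [a b|]; last by rewrite toep_pi0.
by have := toep_pi_linear 1 a b h; rewrite !scale1r.
Qed.

Lemma toep_sg_sum (I : Type) (s : seq I) (f : I -> graph_corr R E) h :
  sg (\sum_(i <- s) f i) h = \sum_(i <- s) sg (f i) h.
Proof.
apply: (big_morph (fun a => sg a h)) => [a b|]; last by rewrite toep_sg0.
by have := toep_sg_linear 1 a b h; rewrite !scale1r.
Qed.

Lemma toep_piP a v h : pi a (P v h) = a v *: P v h.
Proof.
rewrite -bh_amulE -piM -toep_piZ; congr (bh_val (pi _) _); apply: c0_ext => w.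
rewrite -[LHS]/(a w * (w == v)%:R) -[RHS]/(a v * (w == v)%:R).
by have [->|] := eqVneq w v; rewrite ?mulr0.
Qed.

Lemma toep_PP v w h : P v (P w h) = (w == v)%:R *: P w h.
Proof. exact: toep_piP. Qed.

Lemma toep_pi_adj a h k : hdot (pi a h) k = hdot h (pi (star a) k).
Proof. by rewrite piS hdot_starr. Qed.

Lemma toep_P_adj v h k : hdot (P v h) k = hdot h (P v k).
Proof.
rewrite toep_pi_adj; congr (hdot h (bh_val (pi _) k)); apply: c0_ext => w /=.
by rewrite conjC_nat.
Qed.

Lemma toep_piP_comm a v h : P v (pi a h) = a v *: P v h.
Proof.
rewrite -toep_piP -!bh_amulE -!piM; congr (bh_val (pi _) h); apply: c0_ext => w.
exact: mulrC.
Qed.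

Lemma gc_inner_delta (e : edge E) x : gc_inner (gc_delta R e) x = x e *: c0_delta R (src e).
Proof.
apply: c0_ext => v; apply: usumE; rewrite -[X in has_sum _ _ X]/(x e * (v == src e)%:R).
have [->|ve] := eqVneq v (src e).
  rewrite mulr1 -[X in has_sum _ _ X](_ : ((gc_delta R e e : R[i])^* * x e) = _).
    apply: (@has_sum_single _ _ _ _ (fun i => ((gc_delta R e i : R[i])^* * x i)) e) => //.
    by move=> i _ /negbTE ie; rewrite /= ie rmorph0 mul0r.
  by rewrite /= eqxx rmorph1 mul1r.
rewrite mulr0; apply: has_sum0 => i iv /=; have [ie|_] := eqVneq i e.
  by rewrite -iv ie eqxx in ve.
by rewrite rmorph0 mul0r.
Qed.

Lemma toep_SsgE (e : edge E) x h : star (S e) (sg x h) = x e *: P (src e) h.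
Proof. by rewrite -bh_amulE -piI gc_inner_delta toep_piZ. Qed.

Lemma toep_SS (e f : edge E) h : star (S e) (S f h) = (e == f)%:R *: P (src e) h.
Proof. exact: toep_SsgE. Qed.

Lemma toep_PS v (e : edge E) h : P v (S e h) = (v == rng e)%:R *: S e h.
Proof.
rewrite -bh_amulE -sgl -toep_sgZ; congr (bh_val (sg _) _); apply: gc_ext => f.
rewrite -[LHS]/((rng f == v)%:R * (f == e)%:R) -[RHS]/((v == rng e)%:R * (f == e)%:R).
by have [->|_] := eqVneq f e; rewrite ?mulr0// eq_sym.
Qed.

Lemma toep_sgP x v h : sg x (P v h) = sg (gc_ract x (c0_delta R v)) h.
Proof. by rewrite -bh_amulE -sgr. Qed.

Lemma toep_SP v (e : edge E) h : S e (P v h) = (v == src e)%:R *: S e h.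
Proof.
rewrite toep_sgP -toep_sgZ; congr (bh_val (sg _) _); apply: gc_ext => f.
rewrite -[LHS]/((f == e)%:R * (src f == v)%:R) -[RHS]/((v == src e)%:R * (f == e)%:R).
by have [->|_] := eqVneq f e; rewrite ?mulr0 ?mul0r// mulrC eq_sym.
Qed.

Lemma toep_sg_norm x h : `|sg x h| ^+ 2 = hdot h (pi (gc_inner x x) h).
Proof. by rewrite -hdot_norm piI bh_amulE hdot_starr. Qed.

Lemma toep_S_star_P (e : edge E) h : P (src e) (star (S e) h) = star (S e) h.
Proof.
apply: hdot_inj => k; rewrite -toep_P_adj !hdot_starr toep_SP eqxx.
by rewrite scale1r.
Qed.

(* With f = 1 - sqrt (1 - b / M), the positive operator (1 - pi f)^2 is 1 - pi b / M. *)
Lemma toep_pi_le (b : C0 R (vertex E)) (M : R) h :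
  0 < M -> (forall v, 0 <= (b v : R[i]) <= M%:C%C) ->
  hdot h (pi b h) <= M%:C%C * `|h| ^+ 2.
Proof.
move=> M0 bM.
pose r v := complex.Re (b v) / M.
have bE v : b v = (M * r v)%:C%C.
  by rewrite /r mulrC divfK ?gt_eqF// RRe_real// ger0_real//; case/andP: (bM v).
have r01 v : 0 <= r v <= 1.
  by have := bM v; rewrite bE ler0c lecR pmulr_rge0// ger_pMr.
(* C_0 need not have a unit, and the root of [1 - r] need not vanish at infinity. Its complement [f]
   does, because [1 - sqrt (1 - r) <= r] on the unit interval. *)
pose f v : R[i]^o := (1 - Num.sqrt (1 - r v))%:C%C.
have fV : f \in @vanishing_pred R (vertex E).
  apply/asboolP; apply: (vanishing_dom (M := (M^-1)%:C%C) (c0_vanishing b)) => v.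
  rewrite /f bE !normr_normc -rmorphM lecR.
  have nc (x : R) : Normc.normc x%:C%C = `|x| by rewrite /= expr0n addr0 sqrtr_sqr.
  have /andP[r0 r1] := r01 v; rewrite !nc normrM (gtr0_norm M0) mulKf ?gt_eqF//.
  rewrite (ger0_norm r0) ger0_norm ?subr_ge0.
    have s0 : 0 <= 1 - r v by rewrite subr_ge0.
    have s1 : 1 - r v <= 1 by rewrite gerBl.
    have := sqr_sqrtr s0; have := sqrtr_ge0 (1 - r v).
    have : Num.sqrt (1 - r v) <= 1 by rewrite -[leRHS]sqrtr1 ler_wsqrtr.
    nra.
  by rewrite -[leRHS]sqrtr1 ler_wsqrtr// gerBl.
pose F := MkC0 fV.
have Fself : star F = F by apply: c0_ext => v; apply/CrealP/complex_realP; eexists.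
have key : amul F F = 2 *: F - (M^-1)%:C%C *: b.
  apply: c0_ext => v.
  rewrite -[LHS]/(f v * f v) -[RHS]/(2 * f v - (M^-1)%:C%C * b v) bE /f.
  rewrite -!rmorphM (_ : 2 = 2%:C%C); last by rewrite rmorph_nat.
  rewrite -rmorphM -rmorphB; congr (_%:C%C).
  have /andP[r0 r1] := r01 v.
  have s0 : 0 <= 1 - r v by rewrite subr_ge0.
  have := sqr_sqrtr s0; rewrite mulrA mulVf ?gt_eqF// mul1r; nra.
have := hdot_ge0 (h - pi F h); rewrite hdotBl 2!hdotBr.
rewrite (toep_pi_adj F h h) (toep_pi_adj F h (pi F h)) Fself -[pi F (pi F h)]bh_amulE -piM key.
rewrite toep_piB !toep_piZ hdotBr !hdotZr hdot_norm.
set u := hdot h (pi F h); set w := hdot h (pi b h).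
rewrite (_ : _ - _ = `|h| ^+ 2 - (M^-1)%:C%C * w); last by ring.
rewrite subr_ge0 -(@ler_pM2l _ M%:C%C) ?ltcR// mulrA -rmorphM divff ?gt_eqF//.
by rewrite mul1r.
Qed.

Lemma toep_sg_bound (x : graph_corr R E) (M : R) h :
  0 < M -> (forall v, norm2 x v <= M ^+ 2) ->
  `|sg x h| <= M%:C%C * `|h|.
Proof.
move=> M0 xM; have M0' := ltW M0; rewrite -(@ler_pXn2r _ 2) ?nnegrE ?mulr_ge0 ?ler0c//.
rewrite toep_sg_norm exprMn -rmorphXn /=.
apply: (@toep_pi_le (gc_inner x x) (M ^+ 2) h (exprn_gt0 2 M0)) => v.
by rewrite gc_inner_diag ler0c lecR norm2_ge0 xM.
Qed.

Lemma toep_sg_approx (x : graph_corr R E) (eps : R) : 0 < eps -> exists A : {fset edge E},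
  forall h, `|sg x h - \sum_(e <- A) x e *: S e h| <= eps%:C%C * `|h|.
Proof.
(* [gc_approx] controls squared norms, hence its use at the square of [eps]. *)
move=> e0; have [A hA] := gc_approx x (exprn_gt0 2 e0); exists A => h.
have -> : \sum_(e <- A) x e *: S e h = sg (gc_trunc x A) h.
  by rewrite /gc_trunc toep_sg_sum; apply: eq_bigr => e _; rewrite toep_sgZ.
by rewrite -toep_sgB; exact: toep_sg_bound.
Qed.

Lemma toep_pi_bound (a : C0 R (vertex E)) (M : R) h : 0 < M ->
  (forall v, `|a v| <= M%:C%C) -> `|pi a h| <= M%:C%C * `|h|.
Proof.
move=> M0 aM; have M0' := ltW M0; rewrite -(@ler_pXn2r _ 2) ?nnegrE ?mulr_ge0 ?ler0c//.
rewrite -hdot_norm toep_pi_adj -[pi _ (pi _ h)]bh_amulE -piM exprMn -rmorphXn.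
apply: toep_pi_le => [|v]; first exact: exprn_gt0.
rewrite -[(amul (star a) a : C0 R (vertex E)) v]/((a v : R[i])^* * (a v : R[i])).
rewrite mulrC -normCK exprn_ge0//= rmorphXn /=.
apply: lerXn2r (aM v).
  by rewrite nnegrE.
by rewrite nnegrE ler0c.
Qed.

Lemma toep_pi_approx (a : C0 R (vertex E)) (eps : R) : 0 < eps ->
  exists A : {fset vertex E},
  forall h, `|pi a h - \sum_(v <- A) a v *: P v h| <= eps%:C%C * `|h|.
Proof.
move=> e0; have e0C : 0 < eps%:C%C :> R[i] by rewrite ltcR.
have finA := c0_vanishing a e0C; set Z := [set v | _] in finA.
exists (fset_set Z) => h; pose b := \sum_(v <- fset_set Z) a v *: c0_delta R v.
have -> : \sum_(v <- fset_set Z) a v *: P v h = pi b h.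
  by rewrite /b toep_pi_sum; apply: eq_bigr => v _; rewrite toep_piZ.
rewrite -toep_piB; apply: toep_pi_bound => // v.
have -> : (a - b) v = a v - b v by [].
have -> : b v = \sum_(i <- fset_set Z) a i * (v == i)%:R.
  by rewrite /b (@big_morph _ _ (fun y : C0 R (vertex E) => y v) 0 +%R).
have [vZ|vZ] := boolP (v \in fset_set Z).
  rewrite (big_fsetD1 v)//= eqxx mulr1 big1_fset ?addr0 ?subrr ?normr0 ?ler0c => [|i].
    exact: ltW.
  by rewrite !inE eq_sym => /andP[/negbTE -> _] _; rewrite mulr0.
rewrite big1_fset ?subr0; last first.
  by move=> i iZ _; case: eqP => [vi|_]; rewrite ?mulr0// vi iZ in vZ *.
have : ~ (eps%:C%C <= `|a v|).
  by move=> h'; case/negP: vZ; rewrite in_fset_set//; apply/mem_set.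
rewrite normr_normc !lecR => nle; rewrite leNgt; apply/negP => lt.
by apply: nle; exact: ltW.
Qed.

(** The [S e] are partial isometries with mutually orthogonal ranges, so [p] is an orthogonal
    projection of [h]. The identity [main] then gives both bounds. *)
Lemma toep_bessel (B : {fset edge E}) h :
  \sum_(e <- B) `|star (S e) h| ^+ 2 <= `|h| ^+ 2 /\
  `|h - \sum_(e <- B) S e (star (S e) h)| <= `|h|.
Proof.
set p := \sum_(e <- B) S e (star (S e) h).
have hp : hdot h p = \sum_(e <- B) `|star (S e) h| ^+ 2.
  rewrite hdot_sumr; apply: eq_bigr => e _.
  by rewrite -hdot_starl hdot_norm.
have Sp e : e \in B -> star (S e) p = star (S e) h.
  move=> eB; rewrite bh_sum (big_fsetD1 e)// big1_fset => [|f]; last first.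
    by rewrite !inE => /andP[fe _] _; rewrite toep_SS eq_sym (negbTE fe) scale0r.
  by rewrite [LHS]addr0 toep_SS eqxx scale1r toep_S_star_P.
have pp : hdot p p = hdot h p.
  rewrite {1}/p hdot_suml hdot_sumr; apply: eq_fbigr => e eB _.
  by rewrite -hdot_starr Sp// -[RHS]hdot_starl.
have ph : hdot p h = hdot h p.
  rewrite hdotC hp rmorph_sum; apply: eq_bigr => e _ /=.
  by rewrite -hdot_norm -hdotC.
have main : `|h - p| ^+ 2 + hdot h p = `|h| ^+ 2.
  by rewrite -!hdot_norm hdotBl !hdotBr pp ph; ring.
have hp0 : 0 <= hdot h p by rewrite hp sumr_ge0// => e _; exact: exprn_ge0.
rewrite -hp; split; first by rewrite -main lerDr exprn_ge0.
by rewrite -(@ler_pXn2r _ 2) ?nnegrE// -main lerDl.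
Qed.

End ToeplitzOperators.

Section RankOne.
Variables (R : realType) (H : hilbertType R).

Definition rank_one (x k : H) : H -> H := fun h => hdot k h *: x.

Lemma rank_one_adjoint x k : adjoint_of (rank_one k x) (rank_one x k).
Proof. by move=> h h'; rewrite hdotZl hdotZr -hdotC mulrC. Qed.

Lemma rank_one_bounded x k : exists m, op_bound (rank_one x k) m.
Proof.
exists (Normc.normc (`|x| * `|k|)); apply: op_boundP => h.
by rewrite normrZ mulrC -mulrA ler_wpM2l// hdot_CS.
Qed.

Definition bh_rank_one x k : BH H := bh_mk (rank_one_bounded x k)
  (ex_intro (fun S => adjoint_of S (rank_one x k)) _ (rank_one_adjoint x k)).

Lemma bh_rank_oneE x k h : bh_rank_one x k h = hdot k h *: x.
Proof. by []. Qed.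

Lemma bh_id_bounded : exists m, op_bound (@id H) m.
Proof. by exists 1; split=> // h; rewrite mul1r. Qed.

Lemma bh_id_adjoint : exists S : H -> H, adjoint_of S id.
Proof. by exists id. Qed.

Definition bh_id : BH H := bh_mk bh_id_bounded bh_id_adjoint.

End RankOne.

Section Lift.
Variables (R : realType) (H : hilbertType R) (A : starAlgType R) (tau : A -> H -> H).
Hypothesis taurep : star_representation tau.

Lemma lift_bounded t : exists m, op_bound (tau t) m.
Proof.
have [tb _ _ _] := taurep; have [_ [M tM]] := tb t.
by exists (Normc.normc M); exact: op_boundP.
Qed.

Lemma lift_adjoint t : exists S, adjoint_of S (tau t).
Proof. by have [_ _ _ tS] := taurep; exists (tau (star t)) => h k; exact: tS. Qed.

(** A [star_representation] takes values in bare functions; the lift lands in a C*-algebra, to which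
    the universal property applies. *)
Definition bh_lift (t : A) : BH H := bh_mk (lift_bounded t) (lift_adjoint t).

Lemma bh_lift_hom : star_hom bh_lift.
Proof.
have [_ tl tM tS] := taurep; split=> [c a b|a b|a].
- by apply: bh_ext => h; rewrite bh_combE; exact: tl.
- by apply: bh_ext => h; rewrite bh_amulE; rewrite /= tM.
- by apply/esym; apply: bh_star_eq => h k; exact: tS.
Qed.

End Lift.

(** * Nondegeneracy and the common kernel of the vertices *)

Section VertexTotal.
Variables (R : realType) (E : graph) (T : toeplitz_algebra R E).
Variables (H : hilbertType R) (rho : T -> BH H).
Hypothesis rhoH : star_hom rho.
Local Notation sg := (rho \o ta_sigma T).
Local Notation pi := (rho \o ta_pi T).
Let rep : toeplitz_representation sg pi := toeplitz_comp rhoH.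

Lemma small_eq0 (x M : R[i]) : 0 <= M ->
  (forall e : R, 0 < e -> `|x| <= e%:C%C * M) -> x = 0.
Proof.
move=> M0 xM; apply/eqP; rewrite -normr_le0.
have ME : M = (complex.Re M)%:C%C by rewrite RRe_real// ger0_real.
have M1 : 0 < complex.Re M + 1 by rewrite ltr_wpDl// -ler0c -ME.
rewrite (normrR x) lecR; apply/ler_addgt0Pr => e e0; rewrite add0r.
rewrite -lecR -(normrR x); apply: le_trans (xM _ (divr_gt0 e0 M1)) _.
rewrite ME -rmorphM lecR -mulrA ger_pMr// mulrC ler_pdivrMr// mul1r lerDl.
exact: ler01.
Qed.

Section Killed.
Variable k : H.
Hypothesis kP : forall v, rho (ta_vertex T v) k = 0.

Lemma killed_pi a : rho (ta_pi T a) k = 0.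
Proof.
apply/eqP; rewrite -normr_eq0; apply/eqP; apply: (@small_eq0 _ `|k|) => // e e0.
have [A hA] := toep_pi_approx rep a e0; rewrite normr_id.
have := hA k; rewrite big1_fset ?subr0// => v _ _.
by rewrite [X in _ *: X]kP scaler0.
Qed.

Lemma killed_sg x : rho (ta_sigma T x) k = 0.
Proof.
apply/eqP; rewrite -normr_eq0 -sqrf_eq0.
by rewrite (toep_sg_norm rep) killed_pi hdot0r.
Qed.

(** The range of the image of an edge [f] lies in the range of the projection at [rng f], hence is
    orthogonal to [k]. Norm approximation of [ta_sigma T x] by edges extends the orthogonality to
    every [x]. *)
Lemma killed_sg_star x : star (rho (ta_sigma T x)) k = 0.
Proof.
apply: hdot_inj => h; rewrite hdot0r hdot_starr.
apply: (@small_eq0 _ (`|h| * `|k|)) => [|e e0]; first exact: mulr_ge0.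
have [A hA] := toep_sg_approx rep x e0.
have pk : hdot (\sum_(f <- A) x f *: rho (ta_edge T f) h) k = 0.
  rewrite hdot_suml big1_fset// => f _ _; rewrite hdotZl.
  have := toep_PS rep (rng f) f h; rewrite eqxx scale1r /= => <-.
  by rewrite (toep_P_adj rep) [X in hdot _ X]kP hdot0r mulr0.
rewrite -[hdot _ _]subr0 -pk -hdotBl (le_trans (hdot_CS _ _))// mulrA ler_wpM2r//.
Qed.

End Killed.

Hypothesis nondeg : closure [set h | exists (n : nat) (a : 'I_n -> T) (k : 'I_n -> H),
    h = \sum_(i < n) rho (a i) (k i)] = [set: H].

(* A unit vector [u] killed by all the [P_v] is killed by the generators and by
   their adjoints. If [q] is the projection onto the line of [u], conjugation by
   the symmetry [1 - 2q] and then compression by [1 - q] fix the generators, so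
   by the universal property they fix every [rho t]; hence [rho t u = 0]. *)
Lemma vertex_total k : (forall v, rho (ta_vertex T v) k = 0) -> k = 0.
Proof.
move=> kP0; apply/eqP/negPn/negP => k0.
pose u := `|k|^-1 *: k.
have kP v : rho (ta_vertex T v) u = 0 by rewrite bhZ kP0 scaler0.
have u1 : hdot u u = 1.
  by rewrite hdot_norm normrZ normfV normr_id mulVf ?expr1n// normr_eq0.
(* Makes [u] an opaque unit vector, no longer tied to [k]. *)
have [] : exists u, hdot u u = 1 /\ forall v, rho (ta_vertex T v) u = 0 by exists u.
move: u u1 kP => _ _ _ u [u1 kP].
pose q := bh_rank_one u u.
have qs : star q = q by apply: bh_star_eq; exact: rank_one_adjoint.
have ids : star (bh_id H) = bh_id H by apply: bh_star_eq.
have agree t : rho t u = 0 -> star (rho t) u = 0 ->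
    (forall h, hdot u (rho t h) = 0).
  by move=> _ tu h; rewrite -hdot_starl tu hdot0l.
have spi a : star (rho (ta_pi T a)) u = 0.
  have [_ _ rS] := rhoH; have [_ [_ _ pS] _ _ _] := ta_rep T.
  by rewrite -rS -pS killed_pi.
have rho_eigen t : rho t u = hdot u (rho t u) *: u.
  have [w [wE ws]] : exists w : BH H,
      (forall h, w h = h - (2 * hdot u h) *: u) /\ star w = w.
    exists ((-2) *: q + bh_id H); split=> [h|].
      by rewrite bh_combE bh_rank_oneE scalerA mulNr scaleNr addrC.
    by rewrite starD starZ qs ids rmorphN /= conjC_nat.
  have uw h : hdot u (w h) = - hdot u h.
    by rewrite wE hdotBr hdotZr u1; ring.
  have ww h : w (w h) = h.
    by rewrite [LHS]wE uw wE mulrN scaleNr opprK subrK.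
  have wrho x : (forall h, hdot u (rho x h) = 0) -> rho x u = 0 ->
      amul w (amul (rho x) w) = rho x.
    move=> ux xu; apply: bh_ext => h; rewrite !bh_amulE.
    have := wE (rho x (w h)); rewrite ux mulr0 scale0r subr0 => ->.
    by rewrite wE bhB bhZ xu scaler0 subr0.
  have hom : star_hom (fun t => amul w (amul (rho t) w)).
    have [rL rM rS] := rhoH; split=> [c a b|a b|a].
    - by rewrite rL amulDl amulDr amulZl amulZr.
    - by apply: bh_ext => h; rewrite !bh_amulE ww rM bh_amulE.
    - by rewrite !starM ws rS amulA.
  have /(congr1 (fun f : T -> BH H => f t u)) := toeplitz_hom_ext hom rhoH
    (fun x => wrho _ (agree _ (killed_sg kP x) (killed_sg_star kP x)) (killed_sg kP x))
    (fun a => wrho _ (agree _ (killed_pi kP a) (spi a)) (killed_pi kP a)).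
  rewrite !bh_amulE (_ : w u = - u); last first.
    by rewrite wE u1 mulr1 scaler_nat mulr2n opprD addNKr.
  rewrite -scaleN1r bhZ scaleN1r wE hdotNr mulrN scaleNr opprK => y.
  have : (2 : R[i]) *: rho t u = (2 * hdot u (rho t u)) *: u.
    by rewrite scaler_nat mulr2n -{1}y addrC addrA subrr add0r.
  have two0 : (2 : R[i]) != 0 by rewrite pnatr_eq0.
  by rewrite -scalerA => /(scalerI two0).
have rho_u t : rho t u = 0.
  (* By [rho_eigen] the line of [u] is invariant under every [rho s], hence also under the adjoints.
     So [q] commutes with [rho s], which makes the compression by [r] multiplicative. *)
  have comm s h : hdot u (rho s h) *: u = hdot u h *: rho s u.
    rewrite -hdot_starl; have [_ _ rS] := rhoH.
    rewrite -rS rho_eigen hdotZl rS -hdotC hdot_starl [in RHS]rho_eigen scalerA.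
    by rewrite mulrC.
  have [r [rE rs]] : exists r : BH H,
      (forall h, r h = h - hdot u h *: u) /\ star r = r.
    exists ((-1) *: q + bh_id H); split=> [h|].
      by rewrite bh_combE bh_rank_oneE scaleN1r addrC.
    by rewrite starD starZ qs ids rmorphN1.
  have ru : r u = 0 by rewrite rE u1 scale1r subrr.
  have rr h : r (r h) = r h by rewrite [r h in LHS]rE bhB bhZ ru scaler0 subr0.
  have rcomm s h : r (rho s h) = rho s (r h).
    by rewrite !rE bhB bhZ comm.
  have hom : star_hom (fun t => amul (rho t) r).
    have [rL rM rS] := rhoH; split=> [c a b|a b|a].
    - by rewrite rL amulDl amulZl.
    - by apply: bh_ext => h; rewrite !bh_amulE rM bh_amulE rcomm rr.
    - by rewrite !starM rs rS; apply: bh_ext => h; rewrite !bh_amulE -rS rcomm.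
  have rrho x : rho x u = 0 -> amul (rho x) r = rho x.
    by move=> xu; apply: bh_ext => h; rewrite bh_amulE rE bhB bhZ xu scaler0 subr0.
  have /(congr1 (fun f : T -> BH H => f t u)) := toeplitz_hom_ext hom rhoH
    (fun x => rrho _ (killed_sg kP x)) (fun a => rrho _ (killed_pi kP a)).
  by rewrite bh_amulE ru bh_val0 => <-.
(* Nondegeneracy puts some [h] in the span of the ranges at distance less than 1 from [u]; but [h]
   is orthogonal to [u], so the distance is at least 1. *)
have : closure [set h | exists (n : nat) (a : 'I_n -> T) (k : 'I_n -> H),
    h = \sum_(i < n) rho (a i) (k i)] u by rewrite nondeg.
move=> /(_ (ball u 1) (nbhsx_ballx _ _ ltr01)) [h [[n [a [g hE]]]]].
rewrite -ball_normE /ball_ /= => uh.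
have hu0 : hdot u h = 0.
  rewrite hE hdot_sumr big1// => i _; have [_ _ rS] := rhoH.
  by rewrite -hdot_starl -rS rho_u hdot0l.
have u1' : `|u| = 1.
  by apply/eqP; rewrite -(@eqrXn2 _ 2)// expr1n -hdot_norm u1.
have : `|hdot u (u - h)| < 1.
  by rewrite (le_lt_trans (hdot_CS _ _))// u1' mul1r.
by rewrite hdotBr hu0 u1 subr0 normr1 ltxx.
Qed.

End VertexTotal.

Lemma bh_bounded_operator (R : realType) (H : hilbertType R) (T : BH H) : bounded_operator T.
Proof. by split; [exact: bh_linear|exists `|T|; exact: le_bh_norm]. Qed.

(** * The endomorphisms Ad and the comparison of two representations *)

Section AdOperator.
Variables (R : realType) (E : graph) (H : hilbertType R).
Variables (sg : graph_corr R E -> BH H) (pi : C0 R (vertex E) -> BH H).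
Hypothesis rep : toeplitz_representation sg pi.
Local Notation P v := (pi (c0_delta R v)).
Local Notation S e := (sg (gc_delta R e)).

Definition vertex_comm (w : H -> H) : Prop :=
  bounded_operator w /\ forall v h, w (P v h) = P v (w h).

Definition op_ad (w : H -> H) (h : H) : H :=
  usum [set: edge E] (fun e => S e (w (star (S e) h))).

Lemma vertex_comm_id : vertex_comm id.
Proof. by split=> //; exact: (bh_bounded_operator (bh_id H)). Qed.

Lemma vertex_comm_P v : vertex_comm (P v).
Proof.
split=> [|u h]; first exact: bh_bounded_operator.
rewrite !(toep_PP rep); have [->//|_] := eqVneq u v.
by rewrite !scale0r.
Qed.

Lemma vertex_comm_rank_one v h k : vertex_comm (rank_one (P v h) (P v k)).
Proof.
split=> [|u z]; first exact: (bh_bounded_operator (bh_rank_one _ _)).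
rewrite /rank_one bhZ (toep_PP rep) -(toep_P_adj rep) (toep_PP rep).
have [->|_] := eqVneq v u; first by rewrite !scale1r.
by rewrite !scale0r hdot0l scaler0 scale0r.
Qed.

(* [A] commutes with the rank one operators on the range of [P v]. *)
Lemma commuting_scalar v (A : H -> H) : (exists h, P v h != 0) ->
  (forall w, vertex_comm w -> forall h, A (w h) = w (A h)) ->
  (forall h, A (P v h) = A h) ->
  exists c : R[i], forall h, A h = c *: P v h.
Proof.
move=> [k k0] Aw AP; pose c := (hdot (P v k) (P v k))^-1.
exists (c * hdot (P v k) (A (P v k))) => h; rewrite -AP.
have kk0 : hdot (P v k) (P v k) != 0 by apply: contra_neq k0; exact: hdot_eq0.
(* Writes [P v h] as the value, at the fixed vector [P v k], of a rank one operator in the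
   commutant. [A] moves past that operator and acts on [P v k] alone, so the scalar does not depend
   on [h]. *)
have hE : P v h = rank_one (P v (c *: h)) (P v k) (P v k).
  by rewrite /rank_one bhZ scalerA divff// scale1r.
rewrite [in LHS]hE (Aw _ (vertex_comm_rank_one _ _ _)) /rank_one.
by rewrite bhZ scalerA mulrC.
Qed.

Lemma toep_S_norm_le e h : `|S e h| <= `|h|.
Proof.
apply: le_trans (_ : `|P (src e) h| <= _).
  rewrite -(@ler_pXn2r _ 2) ?nnegrE// -!hdot_norm -hdot_starr (toep_SS rep) eqxx scale1r.
  by rewrite (toep_P_adj rep) (toep_PP rep) eqxx scale1r.
have := @toep_pi_bound _ _ _ _ _ rep (c0_delta R (src e)) 1 h ltr01.
rewrite mul1r; apply=> v; rewrite /=.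
by case: (v == _); rewrite ?normr1 ?normr0 ?ler01.
Qed.

(** Rules out the default value of [usum] in [op_ad]. The terms are mutually orthogonal, each of
    norm at most [m] times that of [star (S e) h], and Bessel's inequality bounds the sum of their
    squares. *)
Lemma op_ad_has_sum w h : vertex_comm w ->
  has_sum [set: edge E] (fun e => S e (w (star (S e) h))) (op_ad w h).
Proof.
move=> [[wl [M wM]] wP].
have [|l hl] := @cauchy_has_sum _ H _ setT (fun e => S e (w (star (S e) h)))
   (@cauchy_cvg _); last by rewrite [op_ad _ _](usumE hl).
move=> [e e']; rewrite ltcE /= => /andP[/eqP -> e0].
have [m0 wm] := op_boundP wM; set m := Normc.normc M in m0 wm.
pose g e := complex.Re (`|star (S e) h| ^+ 2).
have gE f : `|star (S f) h| ^+ 2 = (g f)%:C%C.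
  by rewrite /g RRe_real// realX// normr_real.
have m1 : 0 < m ^+ 2 + 1 by rewrite ltr_wpDl// sqr_ge0.
have [||A hA] := @small_tails R (edge E) g (complex.Re (`|h| ^+ 2)) _ _ _
  (divr_gt0 (exprn_gt0 2 e0) m1).
- by move=> f; rewrite -ler0c -gE exprn_ge0.
- move=> B; rewrite -lecR rmorph_sum RRe_real ?realX ?normr_real//.
  by apply: le_trans (toep_bessel rep B h).1; apply: ler_sum => f _; rewrite gE.
exists A => B /hA gB.
rewrite (eq_bigl predT); last by move=> f; apply/mem_set.
change (`|\sum_(i <- B) S i (w (star (S i) h))| < e%:C%C).
have e0' : 0 <= e%:C%C :> R[i] by rewrite ler0c ltW.
rewrite -(@ltr_pXn2r _ 2) ?nnegrE// pythagoras => [|f f' ff']; last first.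
  by rewrite -hdot_starr (toep_SS rep) (negbTE ff') scale0r hdot0r.
apply: (@le_lt_trans _ _ (\sum_(f <- B) (m ^+ 2 * g f)%:C%C)).
  apply: ler_sum => f _; rewrite rmorphM /= -gE rmorphXn -exprMn.
  apply: lerXn2r; rewrite ?nnegrE ?mulr_ge0 ?ler0c//.
  by rewrite (le_trans (toep_S_norm_le _ _))// wm.
rewrite -rmorph_sum -rmorphXn ltcR -mulr_sumr.
move: gB; rewrite ltr_pdivlMr// mulrC; apply: le_lt_trans.
rewrite ler_wpM2r ?lerDl// sumr_ge0// => f _.
by rewrite -ler0c -gE exprn_ge0.
Qed.

(** By continuity [star (S e)] enters the sum and kills every term but its own, where it leaves
    [P (src e)]. This commutes with [w] and fixes the range of [star (S e)]. *)
Lemma star_op_ad w h e : vertex_comm w ->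
  star (S e) (op_ad w h) = w (star (S e) h).
Proof.
move=> cw; have := op_ad_has_sum h cw.
move=> /(@has_sum_map _ _ H _ _ _ _ (star (S e)) `|star (S e)| (bhB _) (le_bh_norm _)).
move=> /has_sum_unique; apply.
have [_ wP] := cw.
rewrite -[X in has_sum _ _ X](_ : (star (S e) \o (fun f => S f (w (star (S f) h)))) e = _).
  apply: has_sum_single => // f _ fe.
  by rewrite [LHS](toep_SS rep) eq_sym (negbTE fe) scale0r.
by rewrite [LHS](toep_SS rep) eqxx scale1r -wP (toep_S_star_P rep).
Qed.

(** The two series agree term by term: [star (S e) (sg x h)] is a multiple of [P (src e) h], and [w]
    commutes with [P (src e)]. *)
Lemma op_ad_sg w x h : vertex_comm w -> op_ad w (sg x h) = op_ad id (sg x (w h)).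
Proof.
move=> [[wl _] wP]; rewrite /op_ad; congr usum; apply/funext => e.
rewrite !(toep_SsgE rep) -wP; congr (S e _).
have w0 : w 0 = 0 by have := wl (-1) 0 0; rewrite scaler0 addr0 scaleN1r addNr.
by have := wl (x e) (P (src e) h) 0; rewrite w0 !addr0.
Qed.

(** The finite combination [p] of the [S f h] is fixed by the partial sum [G] as soon as [B]
    contains [A]. The remainder [sg x h - p] is small, and by Bessel subtracting its image under [G]
    does not increase its norm. *)
Lemma op_ad_id_sg x h : op_ad id (sg x h) = sg x h.
Proof.
apply: usumE; apply/has_sumP => -[e e']; rewrite ltcE /= => /andP[/eqP -> e0].
have h1 : 0 < complex.Re `|h| + 1 by rewrite ltr_wpDl// -ler0c -normrR.
have [A hA] := toep_sg_approx rep x (divr_gt0 e0 h1); exists A => B AB.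
rewrite (eq_bigl predT); last by move=> f; apply/mem_set.
pose p := \sum_(f <- A) x f *: S f h; pose G k := \sum_(f <- B) S f (star (S f) k).
have Gp : G p = p.
  have SpE f : star (S f) p = (if f \in A then x f else 0) *: P (src f) h.
    rewrite bh_sum; have [fA|fA] := boolP (f \in A).
      rewrite (big_fsetD1 f)// big1_fset => [|i]; last first.
        rewrite !inE => /andP[fi _] _; rewrite bhZ (toep_SS rep) eq_sym.
        by rewrite (negbTE fi) scale0r scaler0.
      by rewrite [LHS]addr0 bhZ (toep_SS rep) eqxx scale1r.
    rewrite scale0r big1_fset// => i iA _; rewrite bhZ (toep_SS rep).
    by case: eqP => [fi|_]; rewrite ?scale0r ?scaler0//; rewrite fi iA in fA.
  apply/esym; rewrite /G (eq_bigr (fun f => (if f \in A then x f else 0) *: S f h)).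
    rewrite -(big_fset_incl _ (F := fun f => (if f \in A then x f else 0) *: S f h) AB).
      by apply: eq_fbigr => f fA _; rewrite fA.
    by move=> f _ /negbTE ->; rewrite scale0r.
  by move=> f _; rewrite SpE bhZ (toep_SP rep) eqxx scale1r.
have GB a b : G (a - b) = G a - G b.
  by rewrite /G -sumrB; apply: eq_bigr => f _; rewrite !bhB.
rewrite -/(G (sg x h)) distrC.
have -> : sg x h - G (sg x h) = (sg x h - p) - G (sg x h - p).
  by rewrite GB Gp opprB addrA subrK.
apply: le_lt_trans (toep_bessel rep B _).2 _; apply: le_lt_trans (hA h) _.
rewrite (normrR h) -rmorphM ltcR mulrAC ltr_pdivrMr//.
by rewrite ltr_pM2l// ltrDl.
Qed.

End AdOperator.

(** * Matching the vertices of the two graphs *)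

Section VertexBelow.
Variables (R : realType) (E F : graph) (H : hilbertType R).
Variables (sE : graph_corr R E -> BH H) (pE : C0 R (vertex E) -> BH H).
Variables (sF : graph_corr R F -> BH H) (pF : C0 R (vertex F) -> BH H).
Hypothesis (repE : toeplitz_representation sE pE).
Hypothesis (repF : toeplitz_representation sF pF).
Local Notation P v := (pE (c0_delta R v)).
Local Notation Q v := (pF (c0_delta R v)).
Hypothesis totE : forall h, (forall v, P v h = 0) -> h = 0.
Hypothesis nzF : forall v, exists h, Q v h != 0.
Hypothesis commEF : forall w, vertex_comm pE w <-> vertex_comm pF w.

(* [P v] commutes with the commutant of the [Q]'s, so on the range of [Q w] it
   is a scalar, and an idempotent one. *)
Lemma vertex_below w : exists v, forall h, P v (Q w h) = Q w h.
Proof.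
have [h0 Qh0] := nzF w.
have [v Pv] : exists v, P v (Q w h0) != 0.
  apply: contrapT => nv; case/negP: Qh0; apply/eqP; apply: totE => v.
  by apply: contrapT => /eqP Pv; apply: nv; exists v.
have [|h|c hc] := @commuting_scalar _ _ _ _ _ repF w (fun h => P v (Q w h)) (nzF w).
- move=> z cz h; have [_ zP] := (commEF z).2 cz; have [_ zQ] := cz.
  by rewrite -zQ -zP.
- by rewrite (toep_PP repF) eqxx scale1r.
exists v => h; suff c1 : c = 1 by rewrite hc c1 scale1r.
(* Idempotence leaves 0 and 1 for the scalar, and [Pv] excludes 0. *)
have : c *: (c *: Q w h0) = c *: Q w h0.
  by rewrite -hc -[LHS]bhZ -hc (toep_PP repE) eqxx scale1r.
rewrite hc in Pv.
move/eqP; rewrite -subr_eq0 -[X in _ - X]scale1r -scalerBl.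
by rewrite scaler_eq0 (negbTE Pv) orbF subr_eq0 => /eqP.
Qed.

End VertexBelow.

Section Transfer.
Variables (R : realType) (E F : graph) (H : hilbertType R).
Variables (sE : graph_corr R E -> BH H) (pE : C0 R (vertex E) -> BH H).
Variables (sF : graph_corr R F -> BH H) (pF : C0 R (vertex F) -> BH H).
Hypothesis (repE : toeplitz_representation sE pE).
Hypothesis (repF : toeplitz_representation sF pF).
Local Notation P v := (pE (c0_delta R v)).
Local Notation Q v := (pF (c0_delta R v)).
Local Notation S e := (sF (gc_delta R e)).
Local Notation normc := Normc.normc.
Local Notation norm2 x v := (fine (xhat x v)).
Hypothesis totE : forall h, (forall v, P v h = 0) -> h = 0.
Hypothesis totF : forall h, (forall v, Q v h = 0) -> h = 0.
Hypothesis nzE : forall v, exists h, P v h != 0.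
Hypothesis nzF : forall v, exists h, Q v h != 0.
Hypothesis commEF : forall w, vertex_comm pE w <-> vertex_comm pF w.
Hypothesis adEF : forall w, vertex_comm pE w -> forall h, op_ad sE w h = op_ad sF w h.

(** Applied in both directions, [vertex_below] places [P v] between [Q w] and some [Q w']. Distinct
    [Q]'s are orthogonal and [Q w] is nonzero, so [w = w']; taking adjoints in [P v Q w = Q w]
    identifies the two projections. *)
Lemma vertex_match w : exists v, forall h, P v h = Q w h.
Proof.
have [v PQ] := vertex_below repE repF totE nzF commEF w.
have commFE z : vertex_comm pF z <-> vertex_comm pE z by split=> /commEF.
have [w' QP] := vertex_below repF repE totF nzE commFE v.
exists v => h; have [h0 Qh0] := nzF w.
have ww : w = w'.
  apply/eqP; apply: contraNT Qh0 => ww.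
  by rewrite -PQ -QP PQ (toep_PP repF) (negbTE ww) scale0r.
rewrite -QP -ww; apply: hdot_inj => k.
by rewrite -(toep_P_adj repF) -(toep_P_adj repE) PQ (toep_P_adj repF).
Qed.

(** It runs from [F] to [E], so that functions on the vertices of [E] pull back to [F] as [alpha]
    requires; the inverse of [alpha] arises by exchanging the two graphs. *)
Definition vertex_map w := sval (cid (vertex_match w)).

Lemma vertex_mapP w h : P (vertex_map w) h = Q w h.
Proof. exact: (svalP (cid (vertex_match w))). Qed.

Lemma vertex_map_inj : injective vertex_map.
Proof.
move=> w w' ww; apply/eqP; have [h0 Qh0] := nzF w; apply: contraNT Qh0 => nw.
have QQ h : Q w h = Q w' h by rewrite -!vertex_mapP ww.
have := toep_PP repF w w h0; rewrite eqxx scale1r => <-.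
by rewrite [X in Q w X]QQ (toep_PP repF) [w' == w]eq_sym (negbTE nw) scale0r.
Qed.

Lemma vanishing_comp_inj (a : vertex E -> R[i]) :
  vanishing a -> vanishing (a \o vertex_map).
Proof.
move=> va eps eps0; apply: (finite_preimage (f := vertex_map) _ (va eps eps0)).
by move=> ? ? _ _; exact: vertex_map_inj.
Qed.

(** After each [Q w] both operators act as the scalar [a (vertex_map w)], and by [totF] the [Q w]
    together detect every vector. *)
Lemma transfer_pi (a : C0 R (vertex E)) : exists b : C0 R (vertex F), pF b = pE a.
Proof.
have bV : (a \o vertex_map : vertex F -> R[i]^o) \in @vanishing_pred R (vertex F).
  by apply/asboolP; apply: vanishing_comp_inj; exact: c0_vanishing.
exists (MkC0 bV); apply: bh_ext => h; apply/eqP; rewrite -subr_eq0; apply/eqP.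
apply: totF => w; rewrite bhB (toep_piP_comm repF) -!vertex_mapP.
by rewrite (toep_piP_comm repE) subrr.
Qed.

(* [S_f^* sigma_E(x)] commutes with the commutant, because
   [S_f^* Ad(w) = w S_f^*] and [Ad(w) sigma_E(x) = sigma_E(x) w]. *)
Lemma transfer_coef x (f : edge F) : exists c : R[i], forall h,
  star (S f) (sE x h) = c *: Q (src f) h.
Proof.
have cid' : vertex_comm pE id := vertex_comm_id _.
have cw w : vertex_comm pF w -> forall h, star (S f) (sE x (w h)) = w (star (S f) (sE x h)).
  move=> cw h; have cwE := (commEF w).2 cw.
  rewrite -(star_op_ad repF _ _ cw) -(adEF cwE).
  by rewrite (op_ad_sg repE _ _ cwE) (op_ad_id_sg repE).
apply: (@commuting_scalar _ _ _ _ _ repF (src f) (fun h => star (S f) (sE x h))) => // h.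
by rewrite (cw _ (vertex_comm_P repF _)) (toep_S_star_P repF).
Qed.

Lemma transfer_sg x : exists y : graph_corr R F, sF y = sE x.
Proof.
pose c f := sval (cid (transfer_coef x f)).
have cE f h : star (S f) (sE x h) = c f *: Q (src f) h.
  exact: (svalP (cid (transfer_coef x f))).
(* Bessel's inequality for [F] at the vector [sE x u], where [u] is a unit vector in the range of
   [Q w]. That range is also the range of [P (vertex_map w)], so the square of the norm of [sE x u]
   is the value of [gc_inner x x] at that vertex. *)
have csum w (B : {fset edge F}) :
    \sum_(f <- B | f \in fiber w) normc (c f) ^+ 2 <= norm2 x (vertex_map w).
  have [h0 Qh0] := nzF w; pose u := `|Q w h0|^-1 *: Q w h0.
  have u1 : hdot u u = 1.
    by rewrite hdot_norm normrZ normfV normr_id mulVf ?expr1n// normr_eq0.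
  have Qu : Q w u = u by rewrite bhZ (toep_PP repF) eqxx scale1r.
  have pu a : pE a u = a (vertex_map w) *: u.
    by rewrite -Qu -vertex_mapP (toep_piP repE).
  have := (toep_bessel repF [fset f in B | f \in fiber w] (sE x u)).1.
  rewrite (toep_sg_norm repE) pu hdotZr u1 mulr1 gc_inner_diag -big_fset_condE.
  rewrite -lecR rmorph_sum; apply: le_trans; apply: ler_sum => f /set_mem fw.
  rewrite cE (fw : src f = w) Qu normrZ exprMn -[X in _ <= _ * X]hdot_norm u1 mulr1.
  by rewrite normr_normc -rmorphXn.
have cV : @is_graph_vector R F c.
  have cx w : (xhat c w <= (norm2 x (vertex_map w))%:E)%E by exact: xhat_le_sums.
  have cfin w : (xhat c w < +oo)%E by rewrite (le_lt_trans (cx w))// ltry.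
  split=> //; apply: (vanishing_dom (M := 1) (vanishing_comp_inj (gc_vectorP x).2)) => w.
  rewrite mul1r /= !xhat_fine_norm lecR -lee_fin fineK//.
  by rewrite ge0_fin_numE// xhat_ge0.
exists (MkGraphCorr (asboolT cV)); apply: bh_ext => h.
(* Each side is fixed by its own Ad(1), and the two Ad(1) agree; the resulting series over the edges
   of [F] have equal terms by the choice of [c]. *)
rewrite -(op_ad_id_sg repF) -[RHS](op_ad_id_sg repE) (adEF (vertex_comm_id _)).
by rewrite /op_ad; congr usum; apply/funext => f; rewrite (toep_SsgE repF) cE.
Qed.

End Transfer.

Section Injective.
Variables (R : realType) (E : graph) (H : hilbertType R).
Variables (sg : graph_corr R E -> BH H) (pi : C0 R (vertex E) -> BH H).
Hypothesis rep : toeplitz_representation sg pi.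
Hypothesis nz : forall v, exists h, pi (c0_delta R v) h != 0.

Lemma toep_pi_inj : injective pi.
Proof.
move=> a b ab; apply: c0_ext => v; have [h h0] := nz v.
have := toep_piP rep a v h; rewrite ab (toep_piP rep) => /eqP.
by rewrite -subr_eq0 -scalerBl scaler_eq0 (negbTE h0) orbF subr_eq0 => /eqP.
Qed.

(** [star (S e)] recovers from [sg x] the coefficient [x e] times the nonzero projection at
    [src e]. *)
Lemma toep_sg_inj : injective sg.
Proof.
move=> x y xy; apply: gc_ext => e; have [h h0] := nz (src e).
have := toep_SsgE rep e x h; rewrite xy (toep_SsgE rep) => /eqP.
by rewrite -subr_eq0 -scalerBl scaler_eq0 (negbTE h0) orbF subr_eq0 => /eqP.
Qed.

End Injective.

Lemma intertwined_coherent (R : realType) (E F : graph) (B : cstarAlgType R)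
    (sE : graph_corr R E -> B) (pE : C0 R (vertex E) -> B)
    (sF : graph_corr R F -> B) (pF : C0 R (vertex F) -> B)
    (U : graph_corr R E -> graph_corr R F) (V : graph_corr R F -> graph_corr R E)
    (alpha : C0 R (vertex E) -> C0 R (vertex F))
    (beta : C0 R (vertex F) -> C0 R (vertex E)) :
  toeplitz_representation sE pE -> toeplitz_representation sF pF ->
  injective sE -> injective pE -> injective sF -> injective pF ->
  (forall x, sF (U x) = sE x) -> (forall y, sE (V y) = sF y) ->
  (forall a, pF (alpha a) = pE a) -> (forall b, pE (beta b) = pF b) ->
  coherent_unitary_equivalence U alpha.
Proof.
move=> [sEl [pEl pEM pES] sEr sEle sEi] [sFl [pFl pFM pFS] sFr sFle sFi].
move=> sEI pEI sFI pFI hU hV ha hb; split.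
- by move=> c x y; apply: sFI; rewrite hU sEl sFl !hU.
- split=> [c a b|a b|a]; apply: pFI.
  + by rewrite ha pEl pFl !ha.
  + by rewrite ha pEM pFM !ha.
  + by rewrite ha pES pFS ha.
- by exists beta => a; [apply: pEI; rewrite hb ha|apply: pFI; rewrite ha hb].
exists V; split=> [x|y|x a|a x|x y].
- by apply: sEI; rewrite hV hU.
- by apply: sFI; rewrite hU hV.
- by apply: sFI; rewrite hU sEr sFr hU ha.
- by apply: sFI; rewrite hU sEle sFle hU ha.
- by apply: pFI; rewrite ha sFi sEi hU hV.
Qed.

Section LiftedRepresentation.
Variables (R : realType) (E : graph) (T : toeplitz_algebra R E) (H : hilbertType R).
Variables (tau : T -> H -> H).
Hypothesis rep : star_representation tau.

Lemma vertex_lift_neq0 : faithful_rep tau ->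
  forall v, exists h, (bh_lift rep \o ta_pi T) (c0_delta R v) h != 0.
Proof.
move=> inj v; apply: contrapT => nh; have /eqP := ta_vertex_neq0 T v; apply.
apply: inj; apply/funext => h.
have [rL _ _] := bh_lift_hom rep.
have r0 : bh_lift rep 0 = 0.
  by have := rL (-1) 0 0; rewrite scaler0 addr0 scaleN1r addNr.
transitivity (bh_lift rep 0 h); last by [].
rewrite r0; apply: contrapT => /eqP th; apply: nh; exists h; exact: th.
Qed.

Lemma vertex_commutantE w :
  vertex_commutant tau w <-> vertex_comm (bh_lift rep \o ta_pi T) w.
Proof.
split=> -[bw cw]; split=> //.
  move=> v h; have := cw (tau (ta_vertex T v)).
  move=> /(_ (ex_intro2 _ _ v I erefl)) /(congr1 (fun f => f h)); exact.
by move=> _ [v _ <-]; apply/funext => h; exact: cw.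
Qed.

Lemma AdE w h : Ad tau w h = op_ad (bh_lift rep \o ta_sigma T) w h.
Proof.
rewrite /Ad /op_ad; congr usum; apply/funext => e.
have [_ _ rS] := bh_lift_hom rep.
by rewrite -[star ((bh_lift rep \o ta_sigma T) _)]rS.
Qed.

End LiftedRepresentation.

Theorem theorem3p2 (R : realType) (E F : graph)
    (TE : toeplitz_algebra R E) (TF : toeplitz_algebra R F)
    (H : hilbertType R) (tau1 : TE -> H -> H) (tau2 : TF -> H -> H)
    (rep1 : star_representation tau1) (rep2 : star_representation tau2)
    (faithful1 : faithful_rep tau1) (faithful2 : faithful_rep tau2)
    (nondeg1 : nondegenerate_rep tau1) (nondeg2 : nondegenerate_rep tau2)
    (eq_commutant : vertex_commutant tau1 = vertex_commutant tau2)
    (eq_Ad : forall w : H -> H, vertex_commutant tau1 w ->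
      Ad tau1 w = Ad tau2 w) :
  exists (U : graph_corr R E -> graph_corr R F)
         (alpha : C0 R (vertex E) -> C0 R (vertex F))
         (UA : coherent_unitary_equivalence U alpha),
    tau1 = (fun t => tau2 (Gamma TE TF UA t)).
Proof.
have hom1 := bh_lift_hom rep1; have hom2 := bh_lift_hom rep2.
have trep1 := toeplitz_comp hom1; have trep2 := toeplitz_comp hom2.
have nz1 := vertex_lift_neq0 rep1 faithful1.
have nz2 := vertex_lift_neq0 rep2 faithful2.
have tot1 := vertex_total hom1 nondeg1; have tot2 := vertex_total hom2 nondeg2.
have comm12 w : vertex_comm (bh_lift rep1 \o ta_pi TE) w <->
    vertex_comm (bh_lift rep2 \o ta_pi TF) w.
  by rewrite -!vertex_commutantE eq_commutant.
have comm21 w : vertex_comm (bh_lift rep2 \o ta_pi TF) w <->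
    vertex_comm (bh_lift rep1 \o ta_pi TE) w by split=> /comm12.
have ad12 w : vertex_comm (bh_lift rep1 \o ta_pi TE) w -> forall h,
    op_ad (bh_lift rep1 \o ta_sigma TE) w h = op_ad (bh_lift rep2 \o ta_sigma TF) w h.
  by move=> /vertex_commutantE cw h; rewrite -!AdE eq_Ad.
have ad21 w : vertex_comm (bh_lift rep2 \o ta_pi TF) w -> forall h,
    op_ad (bh_lift rep2 \o ta_sigma TF) w h = op_ad (bh_lift rep1 \o ta_sigma TE) w h.
  by move=> /comm21 cw h; rewrite ad12.
have [alpha alphaP] := choice (transfer_pi trep1 trep2 tot1 tot2 nz1 nz2 comm12).
have [beta betaP] := choice (transfer_pi trep2 trep1 tot2 tot1 nz2 nz1 comm21).
have [U UP] := choice (transfer_sg trep1 trep2 tot1 tot2 nz1 nz2 comm12 ad12).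
have [V VP] := choice (transfer_sg trep2 trep1 tot2 tot1 nz2 nz1 comm21 ad21).
have UA : coherent_unitary_equivalence U alpha.
  apply: (intertwined_coherent trep1 trep2 _ _ _ _ UP VP alphaP betaP).
  - exact: toep_sg_inj trep1 nz1.
  - exact: toep_pi_inj trep1 nz1.
  - exact: toep_sg_inj trep2 nz2.
  - exact: toep_pi_inj trep2 nz2.
exists U, alpha, UA; have [Gh Gs Gp] := GammaP TE TF UA.
(* On generators this is the defining property of [U] and [alpha]; uniqueness in the universal
   property extends it to all of [TE]. *)
have lifts_eq : bh_lift rep1 = bh_lift rep2 \o Gamma TE TF UA.
  apply: (toeplitz_hom_ext hom1 (star_hom_comp hom2 Gh)) => [x|a] /=.
    by have /= <- := congr1 (fun f => f x) Gs; exact/esym/UP.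
  by have /= <- := congr1 (fun f => f a) Gp; exact/esym/alphaP.
apply/funext => t; apply/funext => h.
exact: (congr1 (fun f : TE -> BH H => f t h) lifts_eq).
Qed.
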